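(* Let $n\ge 1$ and let $b=(b_1,\dots,b_n)$ be a sequence of positive integers. The set of quadratic straightening relations $$x_{\pi_1}x_{\pi_2}-x_{\eta_1}x_{\eta_2},$$ where $x_{\pi_1}x_{\pi_2}$ runs over the non-standard monomials of degree $2$ of $\mathcal{A}(b)$ and $\eta_1\oplus\eta_2$ is the canonical decomposition of $\pi_1+\pi_2$, is a Gröbner basis of the ideal $\mathcal{I}$ with respect to the monomial order $\succ$. In particular, $A(b)$ is Koszul.
   Context: For $b=(b_1,\dots,b_n)$ set $b_0=b_{n+1}:=1$ and $N_k:=\mathrm{lcm}(b_k,b_{k-1})$ for $k=1,\dots,n+1$. Let $e_1,\dots,e_{n+1}$ be the canonical basis of $\mathbb{R}^{n+1}$ and let $L(b)\subset\mathbb{R}^{n+1}$ be the lattice generated by $v_j:=\frac{e_j-e_{j+1}}{b_j}$ for $j=1,\dots,n$ and $v_{n+1}:=e_{n+1}$. The monoid of L-S paths with bonds $b$ is $\Pi(b):=L(b)\cap\mathbb{R}^{n+1}_{\ge 0}$. For $\pi=(a_1,\dots,a_{n+1})\in\Pi(b)$, $\operatorname{supp}\pi:=\{j : a_j\ne 0\}$ and $\deg(\pi):=a_1+\cdots+a_{n+1}$, a non-negative integer; $\Pi(b)_k$ is the set of L-S paths of degree $k$. The canonical decomposition of $\pi\in\Pi(b)_k$, written $\pi=\eta_1\oplus\cdots\oplus\eta_k$, is the unique decomposition $\pi=\eta_1+\cdots+\eta_k$ with all $\eta_i\in\Pi(b)_1$ and $\max\operatorname{supp}\eta_j\le\min\operatorname{supp}\eta_{j+1}$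 for $j=1,\dots,k-1$ (it always exists). Let $R:=\mathbb{C}[t_1^{1/N_1},\dots,t_{n+1}^{1/N_{n+1}}]$ be the polynomial algebra in the indeterminates $t_k^{1/N_k}$; for $\pi\in\Pi(b)$ one has $N_ka_k\in\mathbb{Z}_{\ge0}$ and $t^\pi:=t_1^{a_1}\cdots t_{n+1}^{a_{n+1}}\in R$. The semigroup algebra is $A(b):=\bigoplus_{\pi\in\Pi(b)}\mathbb{C}\,t^\pi\subseteq R$, graded by $\deg t^\pi=\deg\pi$. Let $\mathcal{A}(b):=\mathbb{C}[x_\pi\mid\pi\in\Pi(b)_1]$ be the polynomial ring, $\phi:\mathcal{A}(b)\to A(b)$ the algebra homomorphism $x_\pi\mapsto t^\pi$, and $\mathcal{I}:=\ker\phi$. A monomial written as $x_{\pi_1}\cdots x_{\pi_k}$ is in standard form if $\max\operatorname{supp}\pi_j\le\min\operatorname{supp}\pi_{j+1}$ for all $j=1,\dots,k-1$; a monomial is standard if its factors can be rearranged so that it is in standard form, and non-standard otherwise. Order on $\Pi(b)_1$: for $\pi=(a_1,\dots,a_{n+1})$ and $\eta=(c_1,\dots,c_{n+1})$, $\pi\succ\eta$ (and $x_\pi\succ x_\eta$) if and only if the leftmost non-zero entry of $(a_1-c_1,\dots,a_{n+1}-c_{n+1})$ is negative. The monomial order $\succ$ on $\mathcal{A}(b)$ is the associated graded reverse lexicographic order: if $\Pi(b)_1=\{\eta_1\succ\cdots\succ\eta_s\}$, then $x_{\eta_1}^{\alpha_1}\cdots x_{\eta_s}^{\alpha_s}\succ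 x_{\eta_1}^{\beta_1}\cdots x_{\eta_s}^{\beta_s}$ if and only if the first has larger degree, or the degrees are equal and the rightmost non-zero entry of $(\alpha_1-\beta_1,\dots,\alpha_s-\beta_s)$ is negative. A standard graded $\mathbb{C}$-algebra $A$ is Koszul if its residue field $\mathbb{C}=A/A_{>0}$ has a linear graded free resolution over $A$. *)

(* Defs.v *)
From HB Require Import structures.
From mathcomp Require Import all_boot all_order all_algebra.
From mathcomp Require Import finmap.
From mathcomp Require Import complex.
From mathcomp Require Import boolp classical_sets functions cardinality reals.
From mathcomp Require Import mpoly.

Set Implicit Arguments.
Unset Strict Implicit.
Unset Printing Implicit Defensive.

Import Order.TTheory GRing.Theory Num.Theory.

Local Open Scope classical_set_scope.
Local Open Scope ring_scope.

Section Groebner.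

Definition ideal_span (A : comNzRingType) (S : set A) : set A :=
  [set f | exists (k : nat) (c g : 'I_k -> A),
     (forall i, S (g i)) /\ f = \sum_i c i * g i].

Variables (K : fieldType) (s : nat).
Implicit Types (gt : rel 'X_{1..s}) (p : {mpoly K[s]}) (S I G : set {mpoly K[s]}).

Definition is_initial_monomial gt p (m : 'X_{1..s}) : Prop :=
  m \in msupp p /\ forall m', m' \in msupp p -> m' != m -> gt m m'.

Definition initial_ideal gt S : set {mpoly K[s]} :=
  ideal_span [set 'X_[m] | m in
    [set m | exists2 p, S p & is_initial_monomial gt p m]].

Definition groebner_basis gt I G : Prop :=
  [/\ finite_set G, G `<=` I & initial_ideal gt G = initial_ideal gt I].

(* 'X_0 > 'X_1 > ... > 'X_(s-1), so that the "rightmost" entry is the one of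
   largest index.  This is not the (deglex) order carried by 'X_{1..s}. *)
Definition grevlex_gt : rel 'X_{1..s} := fun m1 m2 =>
  (mdeg m2 < mdeg m1)%N
  || (mdeg m1 == mdeg m2)
     && [exists i : 'I_s, (m1 i < m2 i)%N
           && [forall j : 'I_s, (i < j)%N ==> (m1 j == m2 j)]].

End Groebner.

Section Koszul.

Variables (K : fieldType) (A : comAlgType K).
(* [gr d] is the homogeneous component of degree [d]. *)
Variable gr : nat -> set A.

Definition graded_algebra : Prop :=
  [/\ forall d, gr d 0 /\
        forall (c : K) (x y : A), gr d x -> gr d y -> gr d (c *: x + y),
      gr 0 1,
      forall d e (x y : A), gr d x -> gr e y -> gr (d + e) (x * y),
      forall a : A, exists (m : nat) (x : nat -> A),
        (forall d, gr d (x d)) /\ a = \sum_(d < m) x d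
    & forall (m : nat) (x : nat -> A), (forall d, gr d (x d)) ->
        \sum_(d < m) x d = 0 -> forall d, (d < m)%N -> x d = 0].

Definition standard_graded : Prop :=
  [/\ graded_algebra,
      forall a : A, gr 0 a -> exists c : K, a = c%:A
    & exists (r : nat) (x : 'I_r -> A), (forall i, gr 1 (x i)) /\
        forall a : A, exists p : {mpoly K[r]}, a = mmap (in_alg A) x p].

(* The ideal A_{>0}. *)
Definition positive_part : set A :=
  [set a | exists (m : nat) (x : nat -> A),
     (forall d, gr d (x d)) /\ a = \sum_(1 <= d < m) x d].

(* The component of degree [d] of the graded free module
   A(-w_0) + ... + A(-w_(m-1)), whose j-th basis element has degree [w j]. *)
Definition free_gr (m : nat) (w : 'I_m -> nat) (d : nat) : set 'rV[A]_m :=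
  [set x | forall j,
     if (w j <= d)%N then gr (d - w j) (x 0 j) else x 0 j = 0].

(* An exact complex of graded maps
     ... -> F_2 -(d 1)-> F_1 -(d 0)-> F_0 -eps-> K -> 0
   where F_i is free on [beta i] generators of degrees [w i].  The ring
   morphism [aug] makes K (in degree 0) an A-module: [eps] is A-linear for
   the action a . c = aug a * c. *)
Definition graded_free_resolution (aug : {lrmorphism A -> K^o})
    (beta : nat -> nat) (w : forall i, 'I_(beta i) -> nat)
    (eps : {linear 'rV[A]_(beta 0%N) -> K^o | aug \; *%R})
    (d : forall i, {linear 'rV[A]_(beta i.+1) -> 'rV[A]_(beta i)}) : Prop :=
  [/\ (forall e x, (0 < e)%N -> free_gr (w 0%N) e x -> eps x = 0),
      (forall i e x, free_gr (w i.+1) e x -> free_gr (w i) e (d i x)),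
      (forall c : K, exists x, eps x = c),
      (forall x, eps x = 0 <-> exists y, d 0%N y = x)
    & (forall i x, d i x = 0 <-> exists y, d i.+1 y = x)].

(* [aug] is the quotient map of A onto its residue field A / A_{>0} = K. *)
Definition koszul : Prop :=
  standard_graded /\
  exists aug : {lrmorphism A -> K^o},
    (forall a, aug a = 0 <-> positive_part a) /\
    exists beta w eps d,
      @graded_free_resolution aug beta w eps d /\ forall i j, w i j = i.

End Koszul.

(* b_1, ..., b_n are [b 0, ..., b (n-1)], and the coordinates 1, ..., n+1 of
   R^(n+1) are indexed by 'I_n.+1 starting from 0. *)

(* [bond b k] is b_k for 0 <= k <= n+1, where b_0 = b_(n+1) = 1. *)
Definition bond (n : nat) (b : 'I_n -> nat) (k : nat) : nat :=
  if k is k'.+1 then oapp b 1%N (insub k') else 1%N.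

(* [bond_lcm b k] is N_(k+1). *)
Definition bond_lcm (n : nat) (b : 'I_n -> nat) (k : 'I_n.+1) : nat :=
  lcmn (bond b k.+1) (bond b k).

Section LSPaths.

Variables (R : realType) (n : nat) (b : 'I_n -> nat).

Local Notation vec := ('rV[R]_n.+1).
Implicit Types (v u : vec).

Definition LSgen (j : 'I_n.+1) : vec :=
  if unlift ord_max j is Some i
  then (b i)%:R^-1 *: (delta_mx 0 j - delta_mx 0 (lift ord0 i))
  else delta_mx 0 ord_max.

Definition LSlattice : set vec := [set v | inIntSpan (mktuple LSgen) v].

Definition LSpath : set vec :=
  [set v | LSlattice v /\ forall k, 0 <= v 0 k].

Definition LSdeg v : R := \sum_k v 0 k.

Definition LSpath_of_deg (d : nat) : set vec :=
  [set v | LSpath v /\ LSdeg v = d%:R].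

Definition LSsupp v : {set 'I_n.+1} := [set k | v 0 k != 0]%SET.
Definition max_supp v : nat := \max_(k in LSsupp v) (k : nat).
Definition min_supp v : nat := \big[minn/n]_(k in LSsupp v) (k : nat).

Definition standard_form (w : seq vec) : bool :=
  sorted (fun u v => (max_supp u <= min_supp v)%N) w.

Definition canonical_decomposition v (w : seq vec) : Prop :=
  [/\ forall u, u \in w -> LSpath_of_deg 1 u, v = \sum_(u <- w) u
    & standard_form w].

Definition path_gt : rel vec := fun v u =>
  [exists k, (v 0 k - u 0 k < 0)
     && [forall l : 'I_n.+1, (l < k)%N ==> (v 0 l - u 0 l == 0)]].

(* Pi(b)_1 listed in decreasing order eta_1 > ... > eta_s; see [mem_LSlist]
   and [LSlist_sorted]. *)
Definition LSlist : seq vec :=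
  sort (fun v u => (v == u) || path_gt v u) (fset_set (LSpath_of_deg 1)).

Definition LSnum : nat := size LSlist.
Definition LSnth (i : 'I_LSnum) : vec := nth 0 LSlist i.

(* The variables of [{mpoly R[i][n.+1]}] stand for t_k^(1/N_k), so that the
   monomial [m] is t^v with v_k = m_k / N_k. *)
Definition LSvec (m : 'X_{1..n.+1}) : vec :=
  \row_k ((m k)%:R / (bond_lcm b k)%:R).
Definition LSexp v : 'X_{1..n.+1} :=
  [multinom Num.truncn ((bond_lcm b k)%:R * v 0%R k)%R | k < n.+1].
Definition tpow v : {mpoly R[i][n.+1]} := 'X_[LSexp v].

(* A(b), the span of the t^v for v in Pi(b). *)
Definition LSalg_pred : {pred {mpoly R[i][n.+1]}} :=
  fun p => all (fun m => LSvec m \in LSpath) (msupp p).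

Record LSalg := MkLSalg { LSval :> {mpoly R[i][n.+1]}; _ : LSval \in LSalg_pred }.

(* 'X_i is the variable x_(eta_(i+1)). *)
Definition LSphi : {mpoly R[i][LSnum]} -> {mpoly R[i][n.+1]} :=
  mmap (@mpolyC n.+1 _) (fun i => tpow (LSnth i)).

Definition LSideal : set {mpoly R[i][LSnum]} := [set f | LSphi f = 0].

Definition standard_monomial (m : 'X_{1..LSnum}) : Prop :=
  exists2 w : seq 'I_LSnum,
    m = (\sum_(i <- w) U_(i))%MM & standard_form [seq LSnth i | i <- w].

Definition straightening_relations : set {mpoly R[i][LSnum]} :=
  [set g | exists p1 p2 e1 e2 : 'I_LSnum,
     [/\ ~ standard_monomial (U_(p1) + U_(p2))%MM,
         canonical_decomposition (LSnth p1 + LSnth p2) [:: LSnth e1; LSnth e2]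
       & g = 'X_p1 * 'X_p2 - 'X_e1 * 'X_e2]].

Lemma LSpath0 : LSpath 0.
Proof.
split; last by move=> k; rewrite mxE.
by exists [ffun=> 0]; rewrite big1 // => i _; rewrite ffunE mulr0z.
Qed.

Lemma LSpathD v u : LSpath v -> LSpath u -> LSpath (v + u).
Proof.
move=> [[x ->] v0] [[y ->] u0]; split; last first.
  by move=> k; rewrite mxE addr_ge0.
exists [ffun i => x i + y i]; rewrite -big_split /=; apply: eq_bigr => i _.
by rewrite ffunE mulrzDr.
Qed.

Lemma LSvec0 : LSvec 0%MM = 0.
Proof. by apply/rowP => k; rewrite !mxE mnm0E mul0r. Qed.

Lemma LSvecD m1 m2 : LSvec (m1 + m2)%MM = LSvec m1 + LSvec m2.
Proof. by apply/rowP => k; rewrite !mxE mnmDE natrD mulrDl. Qed.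

Lemma LSalg_subalg : subalg_closed LSalg_pred.
Proof.
split.
- rewrite unfold_in /LSalg_pred msupp1 /= andbT LSvec0; exact/mem_set/LSpath0.
- move=> c p q /allP pP /allP qP; apply/allP => m /msuppD_le.
  rewrite mem_cat => /orP[/msuppZ_le|]; [exact: pP | exact: qP].
- move=> p q /allP pP /allP qP; apply/allP => m /msuppM_le.
  move=> /allpairsP[[m1 m2] /= [/pP m1P /qP m2P ->]].
  by apply/mem_set; rewrite LSvecD; apply: LSpathD; exact: set_mem.
Qed.

HB.instance Definition _ :=
  GRing.isSubalgClosed.Build R[i] {mpoly R[i][n.+1]} LSalg_pred LSalg_subalg.
HB.instance Definition _ := [isSub for LSval].
HB.instance Definition _ := [Choice of LSalg by <:].
HB.instance Definition _ := [SubChoice_isSubComNzRing of LSalg by <:].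
HB.instance Definition _ := [SubZmodule_isSubLmodule of LSalg by <:].
HB.instance Definition _ := [SubNzRing_SubLmodule_isSubLalgebra of LSalg by <:].
HB.instance Definition _ := [SubLalgebra_isSubAlgebra of LSalg by <:].

Definition LSalg_gr (d : nat) : set LSalg :=
  [set p | forall m, m \in msupp (LSval p) -> LSdeg (LSvec m) = d%:R].

Lemma path_gt_trans : transitive path_gt.
Proof.
move=> u v w /existsP[k /andP[vuk /forallP vu]] /existsP[l /andP[uwl /forallP uw]].
have vuE (i : 'I_n.+1) : (i < k)%N -> v 0 i = u 0 i.
  by move=> ik; apply/eqP; rewrite -subr_eq0; have := vu i; rewrite ik.
have uwE (i : 'I_n.+1) : (i < l)%N -> u 0 i = w 0 i.
  by move=> il; apply/eqP; rewrite -subr_eq0; have := uw i; rewrite il.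
rewrite !subr_lt0 in vuk uwl; apply/existsP.
have [kl|lk|/val_inj kl] := ltngtP k l.
- exists k; rewrite subr_lt0 -(uwE _ kl) vuk /=; apply/forallP => i.
  by apply/implyP => ik; rewrite (vuE _ ik) (uwE _ (ltn_trans ik kl)) subrr.
- exists l; rewrite subr_lt0 (vuE _ lk) uwl /=; apply/forallP => i.
  by apply/implyP => il; rewrite (vuE _ (ltn_trans il lk)) (uwE _ il) subrr.
- rewrite -kl in uwl uwE; exists k; rewrite subr_lt0 (lt_trans vuk) //=.
  by apply/forallP => i; apply/implyP => ik; rewrite (vuE _ ik) (uwE _ ik) subrr.
Qed.

Lemma path_gt_irr : irreflexive path_gt.
Proof. by move=> v; apply/existsP => -[k]; rewrite subrr ltxx. Qed.

Lemma path_gt_total v u : [|| v == u, path_gt v u | path_gt u v].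
Proof.
have [//|vDu] := eqVneq v u.
have [k0 k0P] : exists k, v 0 k != u 0 k.
  apply/existsP; apply: contraNT vDu => /existsPn vu.
  by apply/eqP/rowP => k; apply/eqP; rewrite -[_ == _]negbK.
case: (@arg_minnP _ k0 (fun k => v 0 k != u 0 k) val k0P) => k kP kmin.
have vuE (i : 'I_n.+1) : (i < k)%N -> v 0 i = u 0 i.
  by move=> ik; apply/eqP; apply: contraLR ik => /kmin; rewrite -leqNgt.
rewrite orFb; apply/orP; have [vuk|uvk|/eqP] := ltgtP (v 0 k) (u 0 k); last by rewrite (negPf kP).
- left; apply/existsP; exists k; rewrite subr_lt0 vuk /=; apply/forallP => i.
  by apply/implyP => ik; rewrite vuE ?subrr.
- right; apply/existsP; exists k; rewrite subr_lt0 uvk /=; apply/forallP => i.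
  by apply/implyP => ik; rewrite vuE ?subrr.
Qed.

Section PositiveBonds.

Hypothesis b_gt0 : forall i, (0 < b i)%N.

Lemma bond_gt0 k : (0 < bond b k)%N.
Proof. by case: k => //= k; case: insubP => [i _ _|_] /=; rewrite ?b_gt0. Qed.

Lemma bond_lcm_gt0 k : (0 < bond_lcm b k)%N.
Proof. by rewrite lcmn_gt0 !bond_gt0. Qed.

Lemma LSgen_int j k : (bond_lcm b k)%:R * LSgen j 0 k \is a Num.int.
Proof.
rewrite /LSgen; case: unliftP => [i ->|_]; last first.
  by rewrite mxE rpredM ?rpred_nat.
rewrite !mxE mulrA.
have bE : bond b i.+1 = b i.
  by rewrite /= insubT //= => ilt; congr b; apply: val_inj.
have bN0 : (b i)%:R != 0 :> R by rewrite pnatr_eq0 -lt0n.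
have [kE|kDj] := eqVneq k (lift ord_max i).
  have /dvdnP[q ->] : (b i %| bond_lcm b k)%N.
    by rewrite -bE -(lift_max i) -kE dvdn_lcml.
  by rewrite natrM mulfK // rpredM ?rpredB ?rpred_nat.
have [kE|kDi] := eqVneq k (lift ord0 i).
  have /dvdnP[q ->] : (b i %| bond_lcm b k)%N.
    by rewrite -bE -(lift0 i) -kE dvdn_lcmr.
  by rewrite natrM mulfK // rpredM ?rpredB ?rpred_nat.
by rewrite !andbF subrr mulr0.
Qed.

Lemma LSpath_nat v k : LSpath v -> (bond_lcm b k)%:R * v 0 k \is a Num.nat.
Proof.
move=> [[z vE] v_ge0]; rewrite natrEint mulr_ge0 ?ler0n // andbT.
rewrite vE summxE mulr_sumr; apply: rpred_sum => j _.
rewrite -tnth_nth tnth_mktuple -scaler_int mxE mulrCA.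
by rewrite rpredM ?intr_int ?LSgen_int.
Qed.

Lemma LSexpE v k : LSpath v -> (LSexp v k)%:R = (bond_lcm b k)%:R * v 0 k.
Proof.
by move=> vP; rewrite mnmE truncnK //; exact: LSpath_nat.
Qed.

Lemma LSexpK v : LSpath v -> LSvec (LSexp v) = v.
Proof.
move=> vP; apply/rowP => k; rewrite mxE LSexpE // mulrAC mulfV ?mul1r //.
by rewrite pnatr_eq0 -lt0n bond_lcm_gt0.
Qed.

Lemma tpow_LSalg v : LSpath v -> tpow v \in LSalg_pred.
Proof.
move=> vP; rewrite unfold_in /LSalg_pred msuppX /= andbT LSexpK //.
exact/mem_set.
Qed.

Lemma finite_LSpath1 : finite_set (LSpath_of_deg 1).
Proof.
pose B := (\sum_k bond_lcm b k).+1.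
apply: (@sub_finite_set _ _ ((fun m : 'X_{1..n.+1 < B} => LSvec m) @` setT));
  last exact/finite_image/finite_finset.
move=> v [vP v1]; have [_ v0] := vP.
have mB : (mdeg (LSexp v) < B)%N.
  rewrite ltnS mdegE; apply: leq_sum => k _.
  rewrite -(ler_nat R) LSexpE // ler_piMr ?ler0n // -[leRHS]/(1%:R) -v1 /LSdeg.
  by rewrite (bigD1 k) //= lerDl sumr_ge0.
by exists (BMultinom mB) => //=; rewrite LSexpK.
Qed.

Lemma mem_LSlist v : v \in LSlist <-> LSpath_of_deg 1 v.
Proof.
rewrite /LSlist mem_sort in_fset_set ?inE //; exact: finite_LSpath1.
Qed.

Lemma LSlist_sorted : sorted path_gt LSlist.
Proof.
have leT : total (fun v u => (v == u) || path_gt v u).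
  move=> v u; have /or3P[/eqP->|->|->] := path_gt_total v u; rewrite ?eqxx ?orbT //.
have trT : transitive (fun v u => (v == u) || path_gt v u).
  move=> u v w /orP[/eqP->//|vu] /orP[/eqP<-|uw]; first by rewrite vu orbT.
  by rewrite (path_gt_trans vu uw) orbT.
have := sort_sorted leT (fset_set (LSpath_of_deg 1)).
have : uniq LSlist by rewrite sort_uniq fset_uniq.
rewrite -/LSlist; case: LSlist => //= v s; elim: s v => //= u s IHs v.
case/and3P => vNs uNs s_uniq /andP[/orP[/eqP vu|->] us].
  by rewrite vu mem_head in vNs.
by rewrite IHs // uNs.
Qed.

Lemma LSphi_LSalg f : LSphi f \in LSalg_pred.
Proof.
rewrite /LSphi /mmap rpred_sum // => m _; rewrite mul_mpolyC rpredZ //.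
rewrite /mmap1 rpred_prod // => i _; rewrite rpredX // tpow_LSalg //.
by have /mem_LSlist[] : LSnth i \in LSlist by exact: mem_nth.
Qed.

End PositiveBonds.

End LSPaths.

Arguments LSgen R {n} b.
Arguments LSlattice R {n} b.
Arguments LSpath R {n} b.
Arguments LSpath_of_deg R {n} b.
Arguments LSlist R {n} b.
Arguments LSnum R {n} b.
Arguments LSphi R {n} b.
Arguments LSideal R {n} b.
Arguments straightening_relations R {n} b.
Arguments LSalg R {n} b.
Arguments LSalg_gr R {n} b.

(* Main.v *)
From HB Require Import structures.
Require Import Defs.
From mathcomp Require Import all_boot all_order all_algebra.
From mathcomp Require Import complex.
From mathcomp Require Import boolp classical_sets cardinality reals.
From mathcomp Require Import mpoly lra.

(** An L-S path is encoded by its partial sums [S_k]: the lattice condition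
    says that [b_k S_k] is an integer for every [k], so truncating all the
    partial sums at 1 splits off the first term of the canonical decomposition.
    A path of degree 1 precedes another one in standard form iff, at every [k],
    the second has partial sum 0 or the first has partial sum 1.  Hence the
    first letter of a standard word has the largest partial sums, i.e. is the
    smallest variable, among the letters of all words with the same sum; so
    standard monomials are the minimal ones in the fibers of [phi], which gives
    the Groebner basis, and standard words are minimal for a lexicographic order
    on words.

    The last fact yields a linear resolution of the residue field in the manner
    of Anick.  The i-th free module has as basis the chains of length i, i.e. the
    words of length i in which no two consecutive letters are standard.  Write
    [p|c] for the standard monomial p times the chain c.  If the word pu is
    standard, the differential sends [p|uc] to [pu|c] plus terms with smaller
    words; if p = qv with vu non-standard, some element of the kernel equals
    [qv|uc] plus terms of the first kind with smaller words.  The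
    terms of the first kind in degree i + 1 thus correspond to those of the
    second kind in degree i, with the same underlying word, and exactness follows
    by induction on i and on words. *)

Set Implicit Arguments.
Unset Strict Implicit.
Unset Printing Implicit Defensive.

Import Order.TTheory GRing.Theory Num.Theory.
Local Open Scope ring_scope.

(** * Lexicographic order on words *)

Section WordOrder.
Variable s : nat.
Implicit Types w : seq 'I_s.

(* The value of [w] in base [s], where the letter [i] is the digit [s - 1 - i]:
   letters of larger index, i.e. smaller variables, come first. *)
Fixpoint word_code w : nat :=
  if w is i :: w' then (rev_ord i * s ^ size w' + word_code w')%N else 0%N.

Definition word_lt w1 w2 : bool :=
  (size w1 == size w2) && (word_code w1 < word_code w2)%N.

Lemma word_code_lt w : (word_code w < s ^ size w)%N.
Proof.
elim: w => [|i w IHw] //=; rewrite expnS.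
apply: (@leq_trans ((rev_ord i).+1 * s ^ size w)); first by rewrite mulSn addnC ltn_add2r.
by rewrite leq_mul2r ltn_ord orbT.
Qed.

Lemma word_code_cat w1 w2 :
  word_code (w1 ++ w2) = (word_code w1 * s ^ size w2 + word_code w2)%N.
Proof.
by elim: w1 => //= i w1 ->; rewrite size_cat expnD mulnDl addnA mulnA.
Qed.

Lemma word_lt_trans : transitive word_lt.
Proof.
move=> w2 w1 w3 /andP[/eqP e12 c12] /andP[/eqP e23 c23].
by rewrite /word_lt e12 e23 eqxx (ltn_trans c12 c23).
Qed.

Lemma word_lt_catl w w1 w2 : word_lt w1 w2 -> word_lt (w ++ w1) (w ++ w2).
Proof.
move=> /andP[/eqP e c]; rewrite /word_lt !size_cat e eqxx /=.
by rewrite !word_code_cat e ltn_add2l.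
Qed.

Lemma word_lt_catr w w1 w2 : word_lt w1 w2 -> word_lt (w1 ++ w) (w2 ++ w).
Proof.
move=> /andP[/eqP e c]; rewrite /word_lt !size_cat e eqxx /= !word_code_cat.
rewrite ltn_add2r ltn_mul2r c andbT.
(* Positivity of [s ^ size w]: a nonempty [w] contains a letter, which forces [0 < s]. *)
by case: w => //= i w; rewrite expn_gt0 (leq_ltn_trans (leq0n _) (ltn_ord i)).
Qed.

(** The tail is worth less than one unit of the leading digit, so the heads decide; [rev_ord] gives
    the larger index the smaller digit. *)
Lemma word_lt_head (i j : 'I_s) w1 w2 :
  size w1 = size w2 -> (j < i)%N -> word_lt (i :: w1) (j :: w2).
Proof.
move=> e ji; rewrite /word_lt /= e eqxx /=.
apply: (@leq_trans ((rev_ord i).+1 * s ^ size w2)).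
  by rewrite mulSn addnC ltn_add2r -e word_code_lt.
apply: leq_trans (leq_addr _ _); rewrite leq_mul2r; apply/orP; right => /=.
by apply: ltn_sub2l => //; exact: leq_ltn_trans ji (ltn_ord i).
Qed.

Lemma word_lt_cons i w1 w2 : word_lt w1 w2 -> word_lt (i :: w1) (i :: w2).
Proof. exact: (@word_lt_catl [:: i]). Qed.

Lemma word_lt_ind (P : seq 'I_s -> Prop) :
  (forall w, (forall w', word_lt w' w -> P w') -> P w) -> forall w, P w.
Proof.
move=> IH w; have [m] := ubnP (word_code w); elim: m => // m IHm in w *.
rewrite ltnS => cm; apply: IH => w' /andP[_ c']; apply: IHm.
exact: leq_trans c' cm.
Qed.

(** Upward induction terminates too, because words of a given length have bounded codes. *)
Lemma word_gt_ind (P : seq 'I_s -> Prop) :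
  (forall w, (forall w', word_lt w w' -> P w') -> P w) -> forall w, P w.
Proof.
move=> IH w; have [m] := ubnP (s ^ size w - word_code w)%N.
elim: m => // m IHm in w *; rewrite ltnS => cm; apply: IH => w' /andP[/eqP e c'].
apply: IHm; apply: leq_trans cm; rewrite e ltn_sub2l //.
by rewrite -e word_code_lt.
Qed.

End WordOrder.

(** * Algebras with a basis of quadratic normal words *)

Section NormalWords.

Variables (K : fieldType) (A : comAlgType K) (gr : nat -> set A).
Variable aug : {lrmorphism A -> K^o}.
Variables (s : nat) (x : 'I_s -> A) (std : rel 'I_s).
Variable coef : seq 'I_s -> {scalar A}.

Definition mon (w : seq 'I_s) : A := \prod_(i <- w) x i.

Definition nchain (i : nat) : nat :=
  #|[pred c : i.-tuple 'I_s | sorted (fun u v => ~~ std u v) c]|.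

Definition chain i (j : 'I_(nchain i)) : seq 'I_s := tval (enum_val j).

Lemma size_chain i (j : 'I_(nchain i)) : size (chain j) = i.
Proof. by rewrite size_tuple. Qed.

Lemma chain_sorted i (j : 'I_(nchain i)) :
  sorted (fun u v => ~~ std u v) (chain j).
Proof. exact: (enum_valP j). Qed.

Lemma chain_inj i : injective (@chain i).
Proof. by move=> j k /val_inj /enum_val_inj. Qed.

Lemma chain_surj c : sorted (fun u v => ~~ std u v) c ->
  exists j : 'I_(nchain (size c)), chain j = c.
Proof.
move=> cs; have cP : in_tuple c \in
    [pred d : (size c).-tuple 'I_s | sorted (fun u v => ~~ std u v) d] by [].
by exists (enum_rank_in cP (in_tuple c)); rewrite /chain enum_rankK_in.
Qed.

Lemma nchain0 : nchain 0 = 1%N.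
Proof.
by rewrite /nchain (eq_card (B := predT)) ?card_tuple // => c; rewrite tuple0.
Qed.

Definition basis_vec i p (j : 'I_(nchain i)) : 'rV[A]_(nchain i) :=
  mon p *: delta_mx 0 j.

Lemma scale_entry m (y : 'rV[A]_m) k j : (k%:A *: y) 0 j = k *: y 0 j.
Proof. by rewrite mxE -scalerAl mul1r. Qed.

(** The [K]-span of the [[p|c]] satisfying [P]. Rows are scaled by elements of [A], hence the
    scalars [k%:A]. *)
Inductive wspan i (P : seq 'I_s -> seq 'I_s -> Prop) : 'rV[A]_(nchain i) -> Prop :=
| wspan0 : wspan P 0
| wspanS k p j y : P p (chain j) -> wspan P y -> wspan P (k%:A *: basis_vec p j + y).

Lemma wspan_basis_vec i P p (j : 'I_(nchain i)) : P p (chain j) -> wspan P (basis_vec p j).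
Proof.
move=> Pp; rewrite -[basis_vec p j]addr0 -[basis_vec p j]scale1r -(scale1r 1).
by apply: wspanS => //; exact: wspan0.
Qed.

Lemma wspanD i P (y z : 'rV_(nchain i)) : wspan P y -> wspan P z -> wspan P (y + z).
Proof.
by move=> yP zP; elim: yP => [|k p j y' Pp _ IH]; rewrite ?add0r // -addrA; apply: wspanS.
Qed.

Lemma wspanZ i P k (y : 'rV_(nchain i)) : wspan P y -> wspan P (k%:A *: y).
Proof.
elim=> [|l p j y' Pp _ IH]; first by rewrite scaler0; exact: wspan0.
have kl : k%:A * l%:A = (k * l)%:A :> A by rewrite -scalerAl mul1r scalerA.
by rewrite scalerDr scalerA kl; exact: wspanS.
Qed.

Lemma wspanN i P (y : 'rV_(nchain i)) : wspan P y -> wspan P (- y).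
Proof. by move=> /(wspanZ (-1)); rewrite scaleN1r scaleN1r. Qed.

Lemma wspanB i P (y z : 'rV_(nchain i)) : wspan P y -> wspan P z -> wspan P (y - z).
Proof. by move=> yP zP; apply/wspanD/wspanN. Qed.

Lemma wspan_map i (P Q : seq 'I_s -> seq 'I_s -> Prop) (y : 'rV_(nchain i)) :
  wspan P y -> (forall p j, P p (@chain i j) -> wspan Q (basis_vec p j)) -> wspan Q y.
Proof.
move=> yP PQ; elim: yP => [|k p j y' Pp _ IH]; first exact: wspan0.
by apply: wspanD => //; apply/wspanZ/PQ.
Qed.

Lemma wspan_sub i (P Q : seq 'I_s -> seq 'I_s -> Prop) (y : 'rV_(nchain i)) :
  wspan P y -> (forall p c, P p c -> Q p c) -> wspan Q y.
Proof. by move=> yP PQ; apply: (wspan_map yP) => p j /PQ; exact: wspan_basis_vec. Qed.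

Definition normal_below (B : seq 'I_s -> Prop) p c := sorted std p /\ B (p ++ c).

(* For [c] a chain and [p] normal, [reduced p c] fails iff the last letter of [p]
   extends [c] to a longer chain. *)
Definition reduced (p c : seq 'I_s) : Prop :=
  if c is u :: _ then sorted std (rcons p u) else p = [::].

Definition reduced_below (B : seq 'I_s -> Prop) p c := reduced p c /\ B (p ++ c).

Definition down_closed (B : seq 'I_s -> Prop) :=
  forall w w', word_lt w' w -> B w -> B w'.

Lemma sorted_rconsl p u : sorted std (rcons p u) -> sorted std p.
Proof. by case: p => //= v p; rewrite rcons_path => /andP[]. Qed.

Lemma reduced_normal p c : reduced p c -> sorted std p.
Proof. by case: c => [->|u c /sorted_rconsl]. Qed.

(** Moving the last letter of [p] across the bar keeps the underlying word and lengthens the chain: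
    this is the matching between non-reduced vectors and reduced ones in the next degree. *)
Lemma not_reduced p i (j : 'I_(nchain i)) : sorted std p -> ~ reduced p (chain j) ->
  exists q u (k : 'I_(nchain i.+1)), p = rcons q u /\ chain k = u :: chain j.
Proof.
case/lastP: p => [_|q u].
  by move=> NR; exfalso; apply: NR; case: (chain j).
move=> qu_std NR; exists q, u.
have uc : sorted (fun u v => ~~ std u v) (u :: chain j).
  have := chain_sorted j; case: (chain j) NR => //= v c NR ->; rewrite andbT.
  apply/negP => uv; apply: NR; case: q qu_std => [|a q] /=; first by rewrite uv.
  by rewrite !rcons_path last_rcons uv andbT.
by have := chain_surj uc; rewrite /= size_chain => -[k <-]; exists k.
Qed.

Lemma chain_behead i (k : 'I_(nchain i.+1)) :
  exists u (j : 'I_(nchain i)), chain k = u :: chain j.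
Proof.
case E : (chain k) => [|u c]; first by have := size_chain k; rewrite E.
have cs : sorted (fun u v => ~~ std u v) c.
  by have := chain_sorted k; rewrite E => /path_sorted.
have ic : size c = i by have := size_chain k; rewrite E => -[].
by have := chain_surj cs; rewrite ic => -[j <-]; exists u, j.
Qed.

(** The next three hypotheses say that the normal words form a basis of [A] with coordinate forms
    [coef], and that passing to the normal form never increases a word. *)
Hypothesis coef_mon : forall p q, sorted std p -> sorted std q ->
  coef p (mon q) = (p == q)%:R.
Hypothesis normal_form : forall w, exists p,
  [/\ sorted std p, mon p = mon w & p = w \/ word_lt p w].
Hypothesis expansion : forall a : A, exists l : seq (seq 'I_s),
  all (sorted std) l /\ a = \sum_(p <- l) coef p a *: mon p.

Lemma mon_cat p q : mon (p ++ q) = mon p * mon q.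
Proof. by rewrite /mon big_cat. Qed.

Lemma mon_basis_vec i p q (j : 'I_(nchain i)) : mon p *: basis_vec q j = basis_vec (p ++ q) j.
Proof. by rewrite /basis_vec scalerA mon_cat. Qed.

Lemma wspan_basis_vec_below i B p (j : 'I_(nchain i)) : down_closed B ->
  B (p ++ chain j) -> wspan (normal_below B) (basis_vec p j).
Proof.
move=> Bdown Bp; have [q [q_std qE [qp|qp]]] := normal_form p.
  by apply: wspan_basis_vec; split=> //; rewrite -qp.
rewrite /basis_vec -qE; apply: wspan_basis_vec; split=> //; apply: Bdown Bp.
exact: word_lt_catr.
Qed.

(** A non-normal [p] differs from its normal form, so the decrease is strict. *)
Lemma wspan_basis_vec_lt i p (j : 'I_(nchain i)) : ~~ sorted std p ->
  wspan (normal_below (fun w => word_lt w (p ++ chain j))) (basis_vec p j).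
Proof.
move=> pN; have [q [q_std qE [qp|qp]]] := normal_form p.
  by rewrite -qp q_std in pN.
rewrite /basis_vec -qE; apply: wspan_basis_vec; split=> //; exact: word_lt_catr.
Qed.

Lemma word_lt_down w0 : down_closed (fun w => word_lt w w0).
Proof. by move=> w w'; exact: word_lt_trans. Qed.

Lemma wspan_mon i p w (y : 'rV_(nchain i)) :
  wspan (normal_below (fun w' => word_lt w' w)) y ->
  wspan (normal_below (fun w' => word_lt w' (p ++ w))) (mon p *: y).
Proof.
elim=> [|k q j y' [q_std qw] _ IH]; first by rewrite scaler0; exact: wspan0.
rewrite scalerDr scalerA mulrC -scalerA mon_basis_vec; apply: wspanD => //; apply: wspanZ.
apply: wspan_basis_vec_below (@word_lt_down _) _.
by rewrite -catA; exact: word_lt_catl.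
Qed.

Lemma expansion_row i (y : 'rV[A]_(nchain i)) :
  exists l : 'I_(nchain i) -> seq (seq 'I_s), (forall j, all (sorted std) (l j)) /\
   y = \sum_j \sum_(p <- l j) (coef p (y 0 j))%:A *: basis_vec p j.
Proof.
have /choice[l lP] := fun j => expansion (y 0 j).
exists l; split=> [j|]; first by have [] := lP j.
rewrite [LHS]row_sum_delta; apply: eq_bigr => j _.
have [_ {1}->] := lP j; rewrite scaler_suml; apply: eq_bigr => p _.
by rewrite /basis_vec scalerA -scalerAl mul1r.
Qed.

Lemma wspanT i (y : 'rV[A]_(nchain i)) : wspan (normal_below (fun=> True)) y.
Proof.
have [l [_ ->]] := expansion_row y.
apply: (big_ind (wspan (normal_below (fun=> True)))) => [|?? ??|j _].
- exact: wspan0.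
- exact: wspanD.
apply: (big_ind (wspan (normal_below (fun=> True)))) => [|?? ??|p _].
- exact: wspan0.
- exact: wspanD.
exact/wspanZ/wspan_basis_vec_below.
Qed.

Lemma coef_basis_vec i p q (j k : 'I_(nchain i)) : sorted std p -> sorted std q ->
  coef p (basis_vec q j 0 k) = ((p == q) && (j == k))%:R.
Proof.
move=> ps qs; rewrite !mxE eqxx /= [k == j]eq_sym.
by case: (j == k); rewrite ?mulr1 ?mulr0 ?linear0 ?andbF // andbT coef_mon.
Qed.

Lemma coef_wspan i (P : _ -> _ -> Prop) p (j : 'I_(nchain i)) (y : 'rV_(nchain i)) :
  (forall p c, P p c -> sorted std p) -> sorted std p -> wspan P y ->
  coef p (y 0 j) != 0 -> P p (chain j).
Proof.
move=> Pstd ps; elim=> [|k q l y' Pq _ IH]; first by rewrite mxE linear0 eqxx.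
rewrite !mxE linearD /= -scalerAl mul1r linearZ /=.
have := coef_basis_vec l j ps (Pstd _ _ Pq); rewrite !mxE => ->.
have [pq|_] := eqVneq p q; last by rewrite mulr0 add0r.
have [<-|_] := eqVneq l j; first by rewrite pq.
by rewrite mulr0 add0r.
Qed.

(* [Z] is a complement of the span of the reduced basis vectors, and the lift to
   [Z] of a non-reduced one only involves smaller words; [Z] is to be the kernel
   of the i-th differential. *)
Record resolvable i (Z : set 'rV[A]_(nchain i)) : Prop := Resolvable {
  resolvable0 : Z 0;
  resolvableP : forall a y z, Z y -> Z z -> Z (a *: y + z);
  resolvable_lift : forall p j, sorted std p -> ~ reduced p (chain j) ->
    exists2 t, wspan (reduced_below (fun w => word_lt w (p ++ chain j))) t
             & Z (basis_vec p j + t);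
  resolvable_indep : forall y, wspan reduced y -> Z y -> y = 0 }.

(** * One step of the resolution *)

Section Step.

Variables (i : nat) (Z : set 'rV[A]_(nchain i)) (M : 'M[A]_(nchain i.+1, nchain i)).
Hypothesis ZP : resolvable Z.
(** The row of [M] at the chain [uc] is a lift of [[u|c]] to [Z]. *)
Hypothesis rowM : forall k u j, chain k = u :: @chain i j ->
  exists2 t, wspan (reduced_below (fun w => word_lt w (chain k))) t
    & row k M = basis_vec [:: u] j + t.
Hypothesis rowZ : forall k, Z (row k M).

Lemma basis_vecM p k u j : chain k = u :: @chain i j -> exists2 t,
  wspan (normal_below (fun w => word_lt w (p ++ chain k))) t
  & basis_vec p k *m M = basis_vec (rcons p u) j + t.
Proof.
move=> kE; have [t tP rE] := rowM kE; exists (mon p *: t).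
  apply/wspan_mon/(wspan_sub tP) => q c [/reduced_normal ? ?]; exact: conj.
by rewrite -scalemxAl -rowE rE scalerDr mon_basis_vec cats1.
Qed.

(** Division by the rows of [M]: a non-reduced [[qu|c]] is the leading term of the image of
    [[q|uc]], and subtracting this image leaves smaller words. *)
Lemma reduce_below B (y : 'rV_(nchain i)) : down_closed B ->
  wspan (normal_below B) y -> exists2 z, wspan (reduced_below B) z
    & wspan (reduced_below B) (y - z *m M).
Proof.
(* Linearity passes from basis vectors to spans. The bound [C] is left free because the induction
   also uses it for the words below [w]. *)
have lin C z : (forall p j, normal_below C p (@chain i j) ->
      exists2 z, wspan (reduced_below C) z & wspan (reduced_below C) (basis_vec p j - z *m M)) ->
    wspan (normal_below C) z ->
    exists2 t, wspan (reduced_below C) t & wspan (reduced_below C) (z - t *m M).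
  move=> CP; elim=> [|k p j z' /CP[t1 t1P u1P] _ [t2 t2P u2P]].
    by exists 0; rewrite ?mul0mx ?subr0; exact: wspan0.
  exists (k%:A *: t1 + t2); first exact/wspanD/t2P/wspanZ.
  rewrite mulmxDl -scalemxAl opprD addrACA -scalerBr.
  exact/wspanD/u2P/wspanZ.
move=> Bdown; apply: (lin B) => p j [ps Bp].
move: {-1}(p ++ chain j) (erefl (p ++ chain j)) => w.
elim/word_lt_ind: w B Bdown p j ps Bp => w IHw B Bdown p j ps Bp wE.
have [pR|pNR] := pselect (reduced p (chain j)).
  by exists 0; rewrite ?mul0mx ?subr0; [exact: wspan0 | exact: wspan_basis_vec].
have [q [u [k [pE kE]]]] := not_reduced ps pNR.
have wE' : q ++ chain k = w by rewrite -wE kE pE cat_rcons.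
have [t tP bE] := basis_vecM q kE; rewrite wE' in tP.
have [|z zP yP] := lin (fun w' => word_lt w' w) t _ tP.
  move=> p' j' [p's p'w].
  exact: (IHw _ p'w (fun w' => word_lt w' w) (@word_lt_down w) _ _ p's p'w (erefl _)).
have sub r c : reduced_below (fun w' => word_lt w' w) r c -> reduced_below B r c.
  by case=> rR rw; split=> //; apply: Bdown rw _; rewrite -wE.
(* The image of [[q|uc]] cancels the leading term, and [z] divides the tail [t] of that image. *)
exists (basis_vec q k - z).
  apply: wspanB; last exact: wspan_sub zP sub.
  apply: wspan_basis_vec; split; last by rewrite wE' -wE.
  by rewrite kE /reduced -pE.
rewrite mulmxBl bE -pE -addrA opprD addrA subrr add0r.
exact/wspanN/(wspan_sub yP).
Qed.

(** On reduced vectors [[p|uc]] to [[pu|c]] is injective and keeps the word, so the coefficient at a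
    largest word of [y] survives in [y *m M]. *)
Lemma ker_indep (y : 'rV_(nchain i.+1)) : wspan reduced y -> y *m M = 0 -> y = 0.
Proof.
move=> yP yM0.
suff c0 p k : sorted std p -> coef p (y 0 k) = 0.
  apply/rowP => k; have [l [l_std ->]] := expansion (y 0 k).
  rewrite mxE big_seq big1 // => p /(allP l_std) ps.
  by rewrite c0 // scale0r.
move=> ps; move: {-1}(p ++ chain k) (erefl (p ++ chain k)) => w.
elim/word_gt_ind: w p k ps => w IHw p k ps wE.
have red q l : sorted std q -> coef q (y 0 l) != 0 -> reduced q (chain l).
  by move=> qs; apply: (coef_wspan _ qs yP) => ? ?; exact: reduced_normal.
apply/eqP/negPn/negP => /[dup] cN0 /(red _ _ ps) pR.
have [u [j kE]] := chain_behead k.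
have pus : sorted std (rcons p u) by move: pR; rewrite kE.
have [l [l_std yE]] := expansion_row y.
have wE' : rcons p u ++ chain j = w by rewrite -wE kE cat_rcons.
(* The leading term of the image of [[q|k']] meets [[pu|c]] only for [[p|k]]. Its tail could meet it
   only if the word of [[q|k']] exceeded [w], where the coefficients of [y] already vanish. *)
have term q k' : sorted std q ->
    coef (rcons p u) (((coef q (y 0 k'))%:A *: basis_vec q k' *m M) 0 j) =
    coef p (((coef q (y 0 k'))%:A *: basis_vec q k') 0 k).
  move=> qs; have [u' [j' k'E]] := chain_behead k'.
  have [->|cqN0] := eqVneq (coef q (y 0 k')) 0.
    by rewrite scale0r scale0r mul0mx !mxE !linear0.
  have qR := red _ _ qs cqN0.
  have qus : sorted std (rcons q u') by move: qR; rewrite k'E.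
  have [t tP bE] := basis_vecM q k'E.
  have t0 : coef (rcons p u) (t 0 j) = 0.
    apply/eqP/negPn/negP => /(coef_wspan _ pus tP)[r c []//|_].
    rewrite wE' => /IHw /(_ _ _ qs (erefl _)) c0; by rewrite c0 eqxx in cqN0.
  rewrite -scalemxAl bE !scale_entry [(_ + t) 0 j]mxE !linearZ linearD /= t0 addr0.
  congr (_ * _); rewrite !coef_basis_vec //.
  congr (nat_of_bool _)%:R; apply/andP/andP => -[/eqP e1 /eqP e2].
    have [-> uu'] := rcons_inj e1; rewrite eqxx; split=> //.
    by apply/eqP/chain_inj; rewrite k'E kE -uu' e2.
  have : chain k' = chain k by rewrite e2.
  by rewrite k'E kE e1 => -[-> /chain_inj ->].
have : coef (rcons p u) ((y *m M) 0 j) = coef p (y 0 k).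
  rewrite {1}yE mulmx_suml [in RHS]yE !summxE !linear_sum /=.
  apply: eq_bigr => k' _; rewrite mulmx_suml !summxE !linear_sum /=.
  by apply: eq_big_seq => q /(allP (l_std k')); exact: term.
by rewrite yM0 mxE linear0 => /esym /eqP; rewrite (negPf cN0).
Qed.

Lemma resolvableD y z : Z y -> Z z -> Z (y + z).
Proof. by move=> yZ zZ; rewrite -[y]scale1r; exact: resolvableP. Qed.

Lemma mulM_in (z : 'rV_(nchain i.+1)) : Z (z *m M).
Proof.
rewrite mulmx_sum_row; apply: (big_ind Z) => [|y y'|k _].
- exact: resolvable0.
- exact: resolvableD.
- by rewrite -[_ *: _]addr0; apply: resolvableP => //; exact: resolvable0.
Qed.

(** The remainder of the division of [y] is reduced and still lies in [Z], so it is zero. *)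
Lemma lift_below B (y : 'rV_(nchain i)) : down_closed B -> Z y ->
  wspan (normal_below B) y -> exists2 z, wspan (reduced_below B) z & z *m M = y.
Proof.
move=> Bdown yZ /(reduce_below Bdown)[z zP yzP]; exists z => //.
apply/esym/subr0_eq/(resolvable_indep ZP).
  by apply: (wspan_sub yzP) => p c [].
rewrite addrC -mulNmx; apply: resolvableD => //; exact: mulM_in.
Qed.

Lemma im_matrix y : Z y <-> exists z, z *m M = y.
Proof.
split=> [yZ|[z <-]]; last exact: mulM_in.
by have [//|z _ zE] := @lift_below (fun=> True) y _ yZ (wspanT y); exists z.
Qed.

(** If [[p|uc]] is not reduced, [pu] is not normal, so its image only involves words below [puc] and
    has a reduced preimage with the same bound. The difference is the lift to the kernel. *)
Lemma resolvable_ker : resolvable [set z | z *m M = 0]%classic.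
Proof.
split=> [|a y z /= yM zM|p k ps NR|y yR]; last exact: ker_indep.
- exact: mul0mx.
- by rewrite mulmxDl -scalemxAl yM zM scaler0 addr0.
have [u [j kE]] := chain_behead k; have [t tP bE] := basis_vecM p kE.
have [|||z zP zE] := @lift_below (fun w => word_lt w (p ++ chain k)) (basis_vec p k *m M).
- exact: word_lt_down.
- exact: mulM_in.
- rewrite bE; apply: wspanD => //; rewrite kE -cat_rcons; apply: wspan_basis_vec_lt.
  by apply/negP => pus; apply: NR; rewrite kE.
exists (- z); first exact: wspanN.
by rewrite /= mulmxBl zE subrr.
Qed.

End Step.

(** * Grading, augmentation and assembly of the linear resolution *)

Hypothesis gr_std : standard_graded gr.
Hypothesis x_gr : forall i, gr 1 (x i).
Hypothesis augP : forall a, aug a = 0 <-> positive_part gr a.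

Lemma gr0 d : gr d 0.
Proof. by have [[grP _ _ _ _] _ _] := gr_std; case: (grP d). Qed.

Lemma grZD d k a a' : gr d a -> gr d a' -> gr d (k *: a + a').
Proof. by have [[grP _ _ _ _] _ _] := gr_std; case: (grP d) => _; apply. Qed.

Lemma mon_gr w : gr (size w) (mon w).
Proof.
have [[_ gr1 grM _ _] _ _] := gr_std.
elim: w => [|i w IHw]; first by rewrite /mon big_nil.
by rewrite /mon big_cons /= -(add1n (size w)); apply: grM.
Qed.

Lemma wspan_gr i (P : _ -> _ -> Prop) d (y : 'rV[A]_(nchain i)) j :
  (forall p c, P p c -> size (p ++ c) = (d + i)%N) -> wspan P y -> gr d (y 0 j).
Proof.
move=> Pd; elim=> [|k p j' y' Pp _ IH]; first by rewrite mxE; exact: gr0.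
rewrite mxE scale_entry; apply: grZD => //.
have pd : size p = d.
  by apply/eqP; have /eqP := Pd _ _ Pp; rewrite size_cat size_chain eqn_add2r.
rewrite !mxE eqxx /=; case: (_ == _); last by rewrite mulr0; exact: gr0.
by rewrite mulr1 -pd; exact: mon_gr.
Qed.

(** The rows of the matrix are chosen lifts of the [[u|c]]. Since [word_lt] compares only words of
    equal length, all their terms have words of length [i.+1], which makes the entries of degree
    1. *)
Lemma resolvable_step i (Z : set 'rV[A]_(nchain i)) : resolvable Z ->
  exists M : 'M[A]_(nchain i.+1, nchain i),
  [/\ forall k j, gr 1 (M k j), forall y, Z y <-> exists z, z *m M = y
    & resolvable [set z | z *m M = 0]%classic].
Proof.
move=> ZP.
have /choice[g gP] : forall k : 'I_(nchain i.+1), exists g : 'rV[A]_(nchain i),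
    Z g /\ forall u j, chain k = u :: @chain i j ->
      exists2 t, wspan (reduced_below (fun w => word_lt w (chain k))) t
        & g = basis_vec [:: u] j + t.
  move=> k; have [u [j kE]] := chain_behead k.
  have uNR : ~ reduced [:: u] (chain j).
    have := chain_sorted k; rewrite kE; case: (chain j) => //= v c.
    by rewrite andbT => /andP[/negbTE ->].
  have [t tP gZ] := resolvable_lift ZP (isT : sorted std [:: u]) uNR.
  exists (basis_vec [:: u] j + t); split=> // u' j'.
  by rewrite kE => -[<- /chain_inj <-]; exists t.
exists (\matrix_k g k).
have rowE k : row k (\matrix_k g k) = g k by rewrite rowK.
split=> [k j|y|].
- have [u [j' kE]] := chain_behead k; have [_ /(_ _ _ kE)[t tP gE]] := gP k.
  rewrite mxE gE; apply: (@wspan_gr i (fun p c => size (p ++ c) = i.+1)) => //.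
  apply: wspanD; first by apply: wspan_basis_vec; rewrite /= size_chain.
  by apply: wspan_sub tP _ => p c [_ /andP[/eqP ->]]; rewrite size_chain.
- apply: im_matrix => // k.
    by move=> u j /(proj2 (gP k)) [t tP gE]; exists t; rewrite ?rowE.
  by rewrite rowE; case: (gP k).
apply: resolvable_ker ZP _ _ => k.
  by move=> u j /(proj2 (gP k)) [t tP gE]; exists t; rewrite ?rowE.
by rewrite rowE; case: (gP k).
Qed.

(** The module has rank one, the empty word being the only chain of length 0; summing avoids naming
    its index. *)
Definition augmentation_sum (y : 'rV[A]_(nchain 0)) : K^o := aug (\sum_j y 0 j).

Lemma augmentation_sum_linear :
  linear_for (aug \; *%R) augmentation_sum.
Proof.
move=> a y z; rewrite /augmentation_sum /=.
under eq_bigr do rewrite !mxE.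
by rewrite big_split -mulr_sumr rmorphD rmorphM.
Qed.

HB.instance Definition _ := GRing.isLinear.Build A 'rV[A]_(nchain 0) K^o
  (aug \; *%R) augmentation_sum augmentation_sum_linear.

Lemma augmentation_sumE (j : 'I_(nchain 0)) y : augmentation_sum y = aug (y 0 j).
Proof.
rewrite /augmentation_sum (bigD1 j) //= big1 ?addr0 // => k /eqP kj.
by case: kj; apply/val_inj; move: k j; rewrite nchain0 => k j; rewrite !ord1.
Qed.

Lemma aug_gr d a : gr d.+1 a -> aug a = 0.
Proof.
move=> aP; apply/augP; exists d.+2, (fun e => if e == d.+1 then a else 0); split.
  by move=> e; case: eqP => [->|_] //; exact: gr0.
rewrite big_nat_recr //= eqxx big_nat big1 ?add0r // => e.
by rewrite ltnS => /andP[_ ed]; case: eqP => // e1; rewrite e1 ltnn in ed.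
Qed.

(** The only reduced vector over the empty chain has empty [p], and [aug 1 = 1]; any other monomial
    has positive degree and is killed by [aug], so its lift needs no tail. *)
Lemma resolvable_aug : resolvable [set y | augmentation_sum y = 0]%classic.
Proof.
have [j0 _] := chain_surj (isT : sorted (fun u v => ~~ std u v) [::]).
have ch0 (j : 'I_(nchain 0)) : chain j = [::] by apply/size0nil; rewrite size_chain.
split=> [|a y z /= yM zM|p k ps|y yR].
- exact: raddf0.
- by rewrite linearP /= yM zM mulr0 addr0.
- rewrite ch0 => pN0; exists 0; first exact: wspan0.
  rewrite /= addr0 (augmentation_sumE k) !mxE !eqxx mulr1.
  case: p pN0 {ps} => [[]|i p _] //; exact: (@aug_gr (size p) _ (mon_gr (i :: p))).
rewrite /= (augmentation_sumE j0).
have [k yE] : exists k, y = k%:A *: basis_vec [::] j0.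
  elim: yR => [|k p j y' pR _ [k' ->]]; first by exists 0; rewrite !scale0r.
  exists (k + k'); rewrite [in RHS]scalerDl [in RHS]scalerDl; congr (_ *: _ + _).
  rewrite ch0 /reduced in pR; rewrite pR; congr basis_vec.
  by apply: chain_inj; rewrite !ch0.
rewrite yE scale_entry linearZ /= !mxE !eqxx mulr1 /mon big_nil rmorph1 => k0.
by rewrite -[k]mulr1 [k * 1]k0 !scale0r.
Qed.

Theorem normal_words_koszul : koszul gr.
Proof.
split=> //; exists aug; split=> //.
(* Each differential depends on the previous kernel, so the kernels are built by recursion together
   with their resolvability. *)
have [Zs [Z0 ZS]] : exists Zs : forall i, {Z : set 'rV[A]_(nchain i) | resolvable Z},
    sval (Zs 0%N) = [set y | augmentation_sum y = 0]%classic /\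
    forall i, exists M : 'M[A]_(nchain i.+1, nchain i),
      [/\ forall k j, gr 1 (M k j), forall y, sval (Zs i) y <-> exists z, z *m M = y
        & sval (Zs i.+1) = [set z | z *m M = 0]%classic].
  pose next i (Z : {Z : set 'rV[A]_(nchain i) | resolvable Z}) :=
    cid (resolvable_step (svalP Z)).
  have nextR i Z : resolvable [set z | z *m sval (next i Z) = 0]%classic.
    by case: (svalP (next i Z)).
  pose Zs := fix Zs i : {Z : set 'rV[A]_(nchain i) | resolvable Z} :=
    if i is i'.+1 then exist _ _ (nextR i' (Zs i')) else exist _ _ resolvable_aug.
  exists Zs; split=> // i; exists (sval (next i (Zs i))).
  by have [grM imM _] := svalP (next i (Zs i)); split.
have [M MP] : exists M : forall i, 'M[A]_(nchain i.+1, nchain i), forall i,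
      [/\ forall k j, gr 1 (M i k j), forall y, sval (Zs i) y <-> exists z, z *m M i = y
        & sval (Zs i.+1) = [set z | z *m M i = 0]%classic].
  by exists (fun i => sval (cid (ZS i))) => i; exact: (svalP (cid (ZS i))).
have [[grP gr1 grM _ _] _ _] := gr_std.
exists nchain, (fun i _ => i), augmentation_sum, (fun i => mulmxr (M i)).
split=> //; split.
- move=> e y e0 yP; have [j0 _] := chain_surj (isT : sorted (fun u v => ~~ std u v) [::]).
  rewrite /= (augmentation_sumE j0); have := yP j0; rewrite /= subn0.
  case: e e0 {yP} => // e _; exact: aug_gr.
- move=> i e y yP j /=; have [Mgr _ _] := MP i.
  rewrite mxE; case: leqP => [ie|ei]; last first.
    rewrite big1 // => k _; have := yP k; rewrite leqNgt (ltnS e) (ltnW ei) /=.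
    by move->; rewrite mul0r.
  apply: (big_ind (gr (e - i))) => [|a a' aP a'P|k _]; first exact: gr0.
    by rewrite -[a]scale1r; exact: grZD.
  have := yP k; case: ltnP => [{}ie yk|_ ->]; last by rewrite mul0r; exact: gr0.
  by rewrite -(subnSK ie) -addn1; apply: grM.
- move=> c; have [j0 _] := chain_surj (isT : sorted (fun u v => ~~ std u v) [::]).
  exists (c%:A *: basis_vec [::] j0); rewrite /= (augmentation_sumE j0) scale_entry.
  by rewrite linearZ /= !mxE !eqxx mulr1 /mon big_nil rmorph1 [LHS]mulr1.
- move=> y /=; have [_ <- _] := MP 0%N; by rewrite Z0.
- move=> i y /=; have [_ _ ZE] := MP i; have [_ <- _] := MP i.+1.
  by rewrite ZE.
Qed.

End NormalWords.

(** * Partial sums of L-S paths *)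

Section PartialSums.

Variables (R : realType) (n : nat) (b : 'I_n -> nat).
Hypothesis b_gt0 : forall i, (0 < b i)%N.
Implicit Types v u : 'rV[R]_n.+1.

Definition psum v (k : nat) : R := \sum_(l < n.+1 | (l < k)%N) v 0 l.

Lemma psum0 v : psum v 0 = 0.
Proof. by rewrite /psum big_pred0. Qed.

Lemma psumS v (k : 'I_n.+1) : psum v k.+1 = psum v k + v 0 k.
Proof.
rewrite /psum (bigD1 k) //= addrC; congr (_ + _); apply: eq_bigl => l.
by rewrite ltnS [in RHS]ltn_neqAle andbC.
Qed.

Lemma psum_deg v : psum v n.+1 = LSdeg v.
Proof. by apply: eq_bigl => l; rewrite ltn_ord. Qed.

Lemma psumD v u k : psum (v + u) k = psum v k + psum u k.
Proof. by rewrite /psum -big_split; apply: eq_bigr => l _; rewrite mxE. Qed.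

Lemma psumZ a v k : psum (a *: v) k = a * psum v k.
Proof. by rewrite /psum mulr_sumr; apply: eq_bigr => l _; rewrite mxE. Qed.

Lemma psum_inj v u : (forall k, (k <= n.+1)%N -> psum v k = psum u k) -> v = u.
Proof.
move=> vu; apply/rowP => k; apply: (addrI (psum v k)).
by rewrite -psumS !vu ?psumS // ltnW.
Qed.

Lemma psum_sum (I : Type) (r : seq I) (F : I -> 'rV[R]_n.+1) k :
  psum (\sum_(i <- r) F i) k = \sum_(i <- r) psum (F i) k.
Proof.
by elim/big_rec2: _ => [|i _ y _ <-]; rewrite ?psumD // /psum big1 // => l _; rewrite mxE.
Qed.

Lemma psum_delta j k : psum (delta_mx 0 j) k = (j < k)%N%:R.
Proof.
rewrite /psum; have [jk|kj] := ltnP j k.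
  rewrite (bigD1 j) //= mxE !eqxx big1 ?addr0 // => l /andP[_ /negbTE lj].
  by rewrite mxE lj andbF.
rewrite big1 // => l lk; rewrite mxE; case: (l =P j) => [lj|]; rewrite ?andbF //.
by rewrite -lj leqNgt lk in kj.
Qed.

(** The forms [b_k S_k] with [k >= 1] are the dual basis of the generators; the shift by one comes
    from counting generators from 0. *)
Lemma bond_psum_LSgen (j : 'I_n.+1) k : (k <= n.+1)%N ->
  (bond b k)%:R * psum (LSgen R b j) k = (k == j.+1)%:R.
Proof.
move=> kn; rewrite /LSgen; case: unliftP => [i ->|->]; last first.
  rewrite psum_delta /=; case: eqP => [->|/eqP kN].
    by rewrite ltnSn /= insubF ?ltnn ?mulr1.
  rewrite ltnNge (_ : (k <= n)%N) ?mulr0 //.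
  by rewrite -ltnS ltn_neqAle kN.
rewrite psumZ -scaleN1r psumD psumZ !psum_delta lift0 lift_max.
have [->|kN] := eqVneq k i.+1.
  rewrite ltnSn ltnn mulr0 addr0 mulr1 /= insubT //= => lt_in.
  rewrite (_ : Sub _ _ = i); last exact: val_inj.
  by rewrite mulfV // pnatr_eq0 -lt0n.
rewrite (_ : (i < k)%N = (i.+1 < k)%N) ?mulN1r ?subrr ?mulr0 //.
by rewrite [RHS]ltn_neqAle eq_sym kN.
Qed.

Lemma LSlatticeP v : LSlattice R b v <->
  forall k, (k <= n.+1)%N -> (bond b k)%:R * psum v k \is a Num.int.
Proof.
split=> [[z ->] k kn|vP].
  rewrite psum_sum mulr_sumr; apply: rpred_sum => j _.
  rewrite -tnth_nth tnth_mktuple -scaler_int psumZ mulrCA bond_psum_LSgen //.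
  by rewrite rpredM ?intr_int ?rpred_nat.
(* By duality these are the coordinates of [v]; they are integers, so [Num.floor] only changes their
   type. *)
exists [ffun j : 'I_n.+1 => Num.floor ((bond b j.+1)%:R * psum v j.+1)].
apply: psum_inj => k kn.
have bN0 : (bond b k)%:R != 0 :> R by rewrite pnatr_eq0 -lt0n bond_gt0.
apply: (mulfI bN0); rewrite psum_sum [RHS]mulr_sumr.
have tE (j : 'I_n.+1) : (bond b k)%:R *
    psum ([tuple LSgen R b i | i < n.+1]`_j *~
      [ffun j : 'I_n.+1 => Num.floor ((bond b j.+1)%:R * psum v j.+1)] j) k =
    (bond b j.+1)%:R * psum v j.+1 * (k == j.+1)%:R.
  rewrite -tnth_nth tnth_mktuple -scaler_int psumZ mulrCA bond_psum_LSgen //.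
  rewrite ffunE; congr (_ * _); apply/eqP; rewrite -intrEfloor; exact: vP.
rewrite (eq_bigr _ (fun j _ => tE j)).
case: k kn {bN0 tE} => [|k] kn.
  by rewrite psum0 mulr0 big1 // => j _; rewrite mulr0.
rewrite (bigD1 (Ordinal kn)) //= eqxx mulr1 big1 ?addr0 // => j jN.
by rewrite eqSS eq_sym (negbTE (_ : (j : nat) != k)) ?mulr0.
Qed.

Lemma psum_le v k l : (forall j, 0 <= v 0 j) -> (k <= l)%N -> psum v k <= psum v l.
Proof.
move=> v0 kl; rewrite /psum [leRHS](bigID (fun j : 'I_n.+1 => (j < k)%N)) /=.
rewrite [X in _ <= X + _](eq_bigl (fun j : 'I_n.+1 => (j < k)%N)); last first.
  by move=> j; rewrite andbC; case: ltnP => //= /leq_trans ->.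
by rewrite lerDl sumr_ge0.
Qed.

Lemma psum_eq0P v k : (forall j, 0 <= v 0 j) ->
  psum v k = 0 <-> forall j : 'I_n.+1, (j < k)%N -> v 0 j = 0.
Proof.
move=> v0; split=> [/eqP|v00]; last exact: big1.
by rewrite /psum psumr_eq0 // => /allP v00 j jk; apply/eqP/(implyP (v00 j _)).
Qed.

Lemma psum_eq_degP v k : (forall j, 0 <= v 0 j) ->
  psum v k = LSdeg v <-> forall j : 'I_n.+1, (k <= j)%N -> v 0 j = 0.
Proof.
move=> v0; rewrite /LSdeg (bigID (fun j : 'I_n.+1 => (j < k)%N)) /= -/(psum v k).
split=> [/eqP|v00].
  rewrite -subr_eq0 opprD addrA subrr add0r oppr_eq0 psumr_eq0 // => /allP vk j kj.
  by apply/eqP/(implyP (vk j _)); rewrite -?leqNgt ?mem_index_enum.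
by rewrite [X in _ + X]big1 ?addr0 // => j; rewrite -leqNgt; exact: v00.
Qed.

Lemma bigminn_le (I : eqType) (r : seq I) (P : pred I) (F : I -> nat) m i :
  i \in r -> P i -> (\big[minn/m]_(j <- r | P j) F j <= F i)%N.
Proof.
move=> ir Pi; elim: r ir => // j r IHr; rewrite inE big_cons => /predU1P[<-|/IHr le].
  by rewrite Pi geq_minl.
by case: ifP => // _; rewrite geq_min le orbT.
Qed.

Definition LSstd v u := (max_supp v <= min_supp u)%N.

(** The order of the supports fails exactly when some cut [k] has mass of [u] before it and mass of
    [v] after it. *)
Lemma LSstdP v u : LSpath_of_deg R b 1 v -> LSpath_of_deg R b 1 u ->
  reflect (forall k, (k <= n.+1)%N -> psum u k = 0 \/ psum v k = 1) (LSstd v u).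
Proof.
move=> [[_ v0] v1] [[_ u0] u1]; apply: (iffP idP) => [vu k kn|vu].
  have [/(psum_eq0P _ u0)|] := pselect (forall j : 'I_n.+1, (j < k)%N -> u 0 j = 0).
    by left.
  move=> /existsNP[j /not_implyP[jk /eqP uj]]; right.
  rewrite -[RHS]v1; apply/psum_eq_degP => // l kl; apply/eqP/negPn/negP => vl.
  have lj : (l <= j)%N.
    apply: leq_trans (leq_trans vu _).
      by apply: (@leq_bigmax_cond _ _ (fun k : 'I_n.+1 => k : nat)); rewrite inE.
    by apply: bigminn_le; rewrite ?mem_index_enum // inE.
  by rewrite leqNgt (leq_trans jk kl) in lj.
apply/bigmax_leqP => j; rewrite inE => vj; rewrite /min_supp.
apply: (big_ind (fun m => (j <= m)%N)) => [|??|l].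
(* The default value [n] of the minimum is the largest index. *)
- by rewrite -ltnS.
- by rewrite leq_min => -> ->.
rewrite inE => ul; rewrite leqNgt; apply: contra vj => lj; apply/eqP.
(* The cut [l.+1] separates [l] from the later index [j]. *)
have [//|/(psum_eq0P _ u0)/(_ l (ltnSn l))/eqP|] := vu l.+1.
  by rewrite (negbTE ul).
by rewrite -[RHS]v1 => /(psum_eq_degP _ v0)/(_ j lj).
Qed.

(** At no cut can the partial sum of the middle path be both 0 and 1. *)
Lemma LSstd_trans v u w : LSpath_of_deg R b 1 v -> LSpath_of_deg R b 1 u ->
  LSpath_of_deg R b 1 w -> LSstd v u -> LSstd u w -> LSstd v w.
Proof.
move=> vP uP wP /(LSstdP vP uP) vu /(LSstdP uP wP) uw; apply/LSstdP => // k kn.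
have [|uk] := uw k kn; first by left.
by have [uk0|] := vu k kn; [move: uk; rewrite uk0 => /eqP; rewrite eq_sym oner_eq0 | right].
Qed.

(* The first term of the canonical decomposition: its partial sums are those of [v]
   truncated at 1. *)
Definition LShead v : 'rV[R]_n.+1 :=
  \row_k (Num.min (psum v k.+1) 1 - Num.min (psum v k) 1).

Lemma psum_head v k : (k <= n.+1)%N -> psum (LShead v) k = Num.min (psum v k) 1.
Proof.
elim: k => [|k IHk] kn; first by rewrite !psum0 min_l // ler01.
by rewrite (psumS _ (Ordinal kn)) IHk ?(ltnW kn) // mxE addrC subrK.
Qed.

Lemma LSpath_head d v : LSpath_of_deg R b d.+1 v ->
  LSpath_of_deg R b 1 (LShead v) /\ LSpath_of_deg R b d (v - LShead v).
Proof.
move=> [[/LSlatticeP vZ v0] vd].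
(* Truncation respects the lattice: [b_k] times the truncated sum is [b_k S_k] or [b_k]. *)
have bint k : (k <= n.+1)%N -> (bond b k)%:R * psum (LShead v) k \is a Num.int.
  move=> kn; rewrite psum_head //; case: leP => _; first exact: vZ.
  by rewrite mulr1 rpred_nat.
have le_psum (k : 'I_n.+1) : psum v k <= psum v k.+1 by apply: psum_le.
have h1 : LSdeg (LShead v) = 1.
  by rewrite -psum_deg psum_head // psum_deg vd min_r // ler1n.
split; split.
- split=> [|k]; first exact/LSlatticeP.
  by rewrite mxE subr_ge0 le_min2.
- exact: h1.
- split=> [|k].
    apply/LSlatticeP => k kn; rewrite -scaleN1r psumD psumZ mulN1r mulrBr.
    by rewrite rpredB ?vZ ?bint.
  (* The partial sums of the remainder are the positive parts of [S_k - 1], hence nondecreasing. *)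
  rewrite !mxE; have := psumS v k; have := le_psum k.
  by move=> lek vk; case: (leP (psum v k) 1) => h1k; case: (leP (psum v k.+1) 1) => h2k; lra.
- by rewrite -psum_deg -scaleN1r psumD psumZ !psum_deg vd h1 -natr1 mulN1r addrK.
Qed.

End PartialSums.

(** * Words in the L-S paths of degree 1 *)

Section LSWords.

Variables (R : realType) (n : nat) (b : 'I_n -> nat).
Hypothesis b_gt0 : forall i, (0 < b i)%N.

Local Notation s := (LSnum R b).
Local Notation eta := (@LSnth R n b).
Implicit Types (v : 'rV[R]_n.+1) (i j : 'I_s) (w p q : seq 'I_s).

Lemma LSnthP i : LSpath_of_deg R b 1 (eta i).
Proof. by apply/(mem_LSlist b_gt0)/mem_nth. Qed.

Lemma LSnth_surj v : LSpath_of_deg R b 1 v -> exists i, eta i = v.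
Proof.
move=> /(mem_LSlist b_gt0) vL; have lt_s : (index v (LSlist R b) < s)%N by rewrite index_mem.
by exists (Ordinal lt_s); rewrite /LSnth nth_index.
Qed.

Lemma LSnth_gt i j : (i < j)%N -> path_gt (eta i) (eta j).
Proof.
move=> ij; apply: (sorted_ltn_nth (@path_gt_trans R n)) => //.
- exact: LSlist_sorted.
- exact: ltn_ord.
- exact: ltn_ord.
Qed.

(** At the first coordinate where two paths differ, the larger entry gives both the larger partial
    sum and the later place in the list. *)
Lemma LSnth_le i j : (forall k, (k <= n.+1)%N -> psum (eta i) k <= psum (eta j) k) ->
  (i <= j)%N.
Proof.
move=> ij; rewrite leqNgt; apply/negP => /LSnth_gt /existsP[k /andP[jik /forallP jiE]].
have jiE' : psum (eta j) k = psum (eta i) k.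
  by apply: eq_bigr => l lk; apply/eqP; rewrite -subr_eq0 (implyP (jiE l)).
by have := ij k.+1 (ltn_ord k); rewrite !psumS jiE' lerD2l leNgt -subr_lt0 jik.
Qed.

Lemma LSnth_ge0 i k : 0 <= eta i 0 k.
Proof. by have [[_ ->]] := LSnthP i. Qed.

Lemma psum_LSnth_le1 i k : (k <= n.+1)%N -> psum (eta i) k <= 1.
Proof.
move=> kn; have [[_ i0] i1] := LSnthP i.
by rewrite -[leRHS]i1 -psum_deg psum_le.
Qed.

Lemma psum_LSnth_ge0 i k : 0 <= psum (eta i) k.
Proof. by apply: sumr_ge0 => j _; exact: LSnth_ge0. Qed.

Definition wsum w : 'rV[R]_n.+1 := \sum_(i <- w) eta i.

Lemma wsum_cons i w : wsum (i :: w) = eta i + wsum w.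
Proof. exact: big_cons. Qed.

Lemma wsumP w : LSpath_of_deg R b (size w) (wsum w).
Proof.
elim: w => [|i w [wP wd]]; rewrite ?wsum_cons.
  rewrite /wsum big_nil; split; first exact: LSpath0.
  by rewrite -psum_deg /psum big1 // => ? _; rewrite mxE.
have [iP i1] := LSnthP i; split; first exact: LSpathD.
by rewrite -psum_deg psumD !psum_deg i1 wd -natrD.
Qed.

Lemma psum_wsum_ge0 w k : 0 <= psum (wsum w) k.
Proof. by apply: sumr_ge0 => j _; have [[_ ->]] := wsumP w. Qed.

Lemma psum_wsum_ge i w k : i \in w -> psum (eta i) k <= psum (wsum w) k.
Proof.
elim: w => // j w IHw; rewrite inE wsum_cons psumD => /predU1P[<-|/IHw le].
  by rewrite lerDl psum_wsum_ge0.
by apply: le_trans le _; rewrite lerDr psum_LSnth_ge0.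
Qed.

Lemma wsum_size p q : wsum p = wsum q -> size p = size q.
Proof.
move=> pq; have [_ pd] := wsumP p; have [_ qd] := wsumP q.
by apply/eqP; rewrite -(eqr_nat R) -pd -qd pq.
Qed.

Definition wstd : rel 'I_s := fun i j => LSstd (eta i) (eta j).

Lemma wstdP i j :
  reflect (forall k, (k <= n.+1)%N -> psum (eta j) k = 0 \/ psum (eta i) k = 1) (wstd i j).
Proof. exact: LSstdP (LSnthP i) (LSnthP j). Qed.

Lemma wstd_trans : transitive wstd.
Proof. by move=> j i k; apply: LSstd_trans; exact: LSnthP. Qed.

Lemma wstd_le i j : wstd i j -> (j <= i)%N.
Proof.
move=> /wstdP ij; apply: LSnth_le => k kn.
by have [->|->] := ij k kn; [exact: psum_LSnth_ge0 | exact: psum_LSnth_le1].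
Qed.

(** Either all later letters have partial sum 0 at [k] and the head carries the total, or one of
    them does not and the head has reached 1. *)
Lemma psum_std_head i w k : sorted wstd (i :: w) -> (k <= n.+1)%N ->
  psum (eta i) k = Num.min (psum (wsum (i :: w)) k) 1.
Proof.
move=> /(order_path_min wstd_trans) /allP iw kn.
have [/eqP w0|wN0] := boolP (psum (wsum w) k == 0).
  by rewrite wsum_cons psumD w0 addr0 min_l // psum_LSnth_le1.
have [j jw jk] : exists2 j, j \in w & psum (eta j) k != 0.
  apply/hasP; apply: contraNT wN0 => /hasPn w0.
  rewrite psum_sum big_seq big1 // => j /w0; by rewrite negbK => /eqP.
have /wstdP/(_ k kn) [/eqP|ik] := iw j jw; first by rewrite (negPf jk).
by rewrite min_r // -[leLHS]ik psum_wsum_ge // mem_head.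
Qed.

Lemma std_head_ge i w p j : sorted wstd (i :: w) -> wsum (i :: w) = wsum p ->
  j \in p -> (j <= i)%N.
Proof.
move=> iw iwp jp; apply: LSnth_le => k kn.
by rewrite (psum_std_head iw kn) iwp le_min psum_wsum_ge // psum_LSnth_le1.
Qed.

(** The standard head has the largest index among all letters of [q], i.e. the smallest leading
    digit; equal heads cancel. *)
Lemma std_word_min p q : sorted wstd p -> wsum p = wsum q -> p = q \/ word_lt p q.
Proof.
elim: p q => [|i p IHp] [|j q] p_std pq; try by have := wsum_size pq.
  by left.
have sz := wsum_size pq.
have := std_head_ge p_std pq (mem_head j q); rewrite leq_eqVlt => /predU1P[/val_inj ji|ji].
  move: pq p_std; rewrite ji !wsum_cons => /addrI pq /path_sorted p_std.
  by have [->|lt] := IHp q p_std pq; [left | right; exact: word_lt_cons].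
by right; apply: word_lt_head => //; case: sz.
Qed.

Lemma std_word_exists d v : LSpath_of_deg R b d v ->
  exists w, [/\ size w = d, sorted wstd w & wsum w = v].
Proof.
elim: d v => [|d IHd] v vP.
  exists [::]; split=> //; have [[_ v0] vd] := vP.
  rewrite /wsum big_nil; apply/rowP => k; rewrite mxE; apply/esym.
  by apply: (psum_eq0P n.+1 v0).1 => //; rewrite psum_deg.
have [hP rP] := LSpath_head b_gt0 vP.
have [w [wd w_std wE]] := IHd _ rP; have [i iE] := LSnth_surj hP.
exists (i :: w); split; rewrite /= ?wd //; last by rewrite wsum_cons wE iE addrC subrK.
(* Where the head has not reached 1 it has absorbed the whole partial sum, so the letters of the
   remainder have partial sum 0. *)
have iw j : j \in w -> wstd i j.
  move=> jw; apply/wstdP => k kn; rewrite iE psum_head //.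
  have := psum_wsum_ge k jw; have := psum_LSnth_ge0 j k.
  rewrite wE -scaleN1r psumD psumZ psum_head //.
  case: (leP (psum v k) 1) => h j0 jh; [left | by right].
  by apply/eqP; rewrite eq_le j0 (le_trans jh) // mulN1r subrr.
by case: w w_std iw {wd wE} => //= j w -> ->; rewrite ?mem_head.
Qed.

(** As [b_(n+1) = 1], the last integrality condition concerns the degree itself. *)
Lemma LSdeg_nat v : LSpath R b v -> exists d, LSpath_of_deg R b d v.
Proof.
move=> vP; have [/(LSlatticeP b_gt0 v)/(_ n.+1 (leqnn _)) vZ v0] := vP.
have bE : bond b n.+1 = 1%N by rewrite /= insubF ?ltnn.
have : LSdeg v \is a Num.nat.
  by rewrite natrEint sumr_ge0 // andbT -psum_deg -[psum _ _]mul1r; move: vZ; rewrite bE.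
by move=> /natrP[d dE]; exists d.
Qed.

End LSWords.

(** * The Groebner basis *)

Section WordMonomials.

Variable s : nat.
Implicit Types (i j : 'I_s) (w : seq 'I_s) (m : 'X_{1..s}).

Definition mword w : 'X_{1..s} := (\sum_(i <- w) U_(i))%MM.

Lemma mword_cons i w : mword (i :: w) = (U_(i) + mword w)%MM.
Proof. exact: big_cons. Qed.

Lemma mwordE w i : mword w i = count_mem i w.
Proof.
elim: w => [|j w IHw]; first by rewrite /mword big_nil mnm0E.
by rewrite mword_cons mnmDE mnm1E IHw.
Qed.

Lemma mdeg_mword w : mdeg (mword w) = size w.
Proof.
elim: w => [|j w IHw]; first by rewrite /mword big_nil mdeg0.
by rewrite mword_cons mdegD mdeg1 IHw.
Qed.

Lemma mword_perm w1 w2 : perm_eq w1 w2 <-> mword w1 = mword w2.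
Proof.
split=> [w12|w12]; first exact: perm_big.
by apply/allP => i _ /=; rewrite -!mwordE w12.
Qed.

Lemma mword_surj m : exists w, m = mword w.
Proof.
exists (flatten [seq nseq (m i) i | i <- enum 'I_s]).
apply/mnmP => i; rewrite mwordE count_flatten -map_comp.
rewrite sumnE big_map big_enum /= (bigD1 i) //= count_nseq /= eqxx mul1n.
by rewrite big1 ?addn0 // => j /negbTE ji; rewrite count_nseq /= ji.
Qed.

Lemma mmap1_mword (K : comNzRingType) (h : 'I_s -> K) w :
  mmap1 h (mword w) = \prod_(i <- w) h i.
Proof.
elim: w => [|i w IHw]; first by rewrite /mword !big_nil mmap11.
by rewrite mword_cons commr_mmap1_M ?mmap1U ?IHw ?big_cons // => *; apply: mulrC.
Qed.

Lemma grevlex_gt_asym m1 m2 : grevlex_gt m1 m2 -> grevlex_gt m2 m1 -> False.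
Proof.
move=> /orP[lt|/andP[/eqP e /existsP[i /andP[iP /forallP iM]]]].
  by case/orP => [/(ltn_trans lt)|/andP[/eqP e _]]; rewrite ?ltnn // e ltnn in lt *.
case/orP => [|/andP[_ /existsP[j /andP[jP /forallP jM]]]]; first by rewrite e ltnn.
have [ij|ji|/val_inj ij] := ltngtP i j.
- by move: (implyP (iM j) ij) jP => /eqP ->; rewrite ltnn.
- by move: (implyP (jM i) ji) iP => /eqP ->; rewrite ltnn.
- by have := ltn_trans iP; rewrite ij => /(_ _ jP); rewrite ltnn.
Qed.

Lemma grevlex_gtD2l m m1 m2 : grevlex_gt m1 m2 -> grevlex_gt (m + m1)%MM (m + m2)%MM.
Proof.
rewrite /grevlex_gt !mdegD ltn_add2l eqn_add2l => /orP[-> //|].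
move=> /andP[-> /existsP[i /andP[iP /forallP iM]]]; apply/orP; right; apply/existsP; exists i.
rewrite !mnmDE ltn_add2l iP; apply/forallP => j; apply/implyP => ij.
by rewrite !mnmDE eqn_add2l (implyP (iM j)).
Qed.

Lemma unsorted_split (r : rel 'I_s) w : ~~ sorted r w ->
  exists a u v c, w = a ++ [:: u, v & c] /\ ~~ r u v.
Proof.
elim: w => // u [|v w] //= IHw; rewrite negb_and => /orP[uv|/IHw].
  by exists [::], u, v, w.
by case=> a [u' [v' [c [-> uv]]]]; exists (u :: a), u', v', c.
Qed.

End WordMonomials.

Lemma ideal_span_sub (A : comNzRingType) (S T : set A) :
  (forall f, S f -> exists h t, T t /\ f = h * t) ->
  (ideal_span S `<=` ideal_span T)%classic.
Proof.
move=> ST f [k [c [g [gS ->]]]].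
have /choice[h /choice[t hP]] := fun i => ST _ (gS i).
exists k, (fun i => c i * h i), t; split=> [i|]; first by case: (hP i).
by apply: eq_bigr => i _; rewrite -mulrA; case: (hP i) => _ <-.
Qed.

(** * Straightening relations and initial ideals *)

Section Straightening.

Variables (R : realType) (n : nat) (b : 'I_n -> nat).
Hypothesis b_gt0 : forall i, (0 < b i)%N.

Local Notation s := (LSnum R b).
Local Notation eta := (@LSnth R n b).
Local Notation wstd := (@wstd R n b).
Implicit Types (i j : 'I_s) (p q w : seq 'I_s).

Lemma standard_monomialP (m : 'X_{1..s}) :
  standard_monomial m <-> exists2 w, m = mword w & sorted wstd w.
Proof.
by split=> -[w -> ws]; exists w => //; move: ws; rewrite /standard_form sorted_map.
Qed.

(** A head [i] of [p] occurring in [q] is cancelled. Otherwise [i] is the largest index in both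
    words and occurs only in [p], so the comparison is decided there. *)
Lemma std_word_grevlex p q : sorted wstd p -> wsum p = wsum q ->
  mword q <> mword p -> grevlex_gt (mword q) (mword p).
Proof.
elim: p q => [|i p IHp] q p_std pq qp.
  by have := wsum_size b_gt0 pq; case: q qp {pq} => // /(_ erefl).
have sz := wsum_size b_gt0 pq.
have [iq|iNq] := boolP (i \in q).
  have /perm_to_rem qi := iq; have qE := proj1 (mword_perm _ _) qi.
  rewrite qE !mword_cons in qp *; apply: grevlex_gtD2l; apply: IHp.
  - exact: path_sorted p_std.
  - by apply: (addrI (eta i)); rewrite -!wsum_cons pq; apply: perm_big.
  - by move=> e; case: qp; rewrite e.
apply/orP; right; rewrite !mdeg_mword -sz eqxx; apply/existsP; exists i.
rewrite !mwordE (count_memPn iNq) /= eqxx /=; apply/forallP => j; apply/implyP => ij.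
rewrite !mwordE (count_memPn _) ?[(i == j) + _]/(count_mem j (i :: p)) ?(count_memPn _) //.
  by apply: contraL ij => jp; rewrite -leqNgt (std_head_ge b_gt0 p_std (erefl _) jp).
by apply: contraL ij => jq; rewrite -leqNgt (std_head_ge b_gt0 p_std pq jq).
Qed.

Lemma nonstandard_pair i j :
  ~ standard_monomial (U_(i) + U_(j))%MM <-> ~~ wstd i j && ~~ wstd j i.
Proof.
have ijE : (U_(i) + U_(j))%MM = mword [:: i; j] by rewrite /mword !big_cons big_nil addm0.
split=> [ijN|/andP[ijN jiN] /standard_monomialP[w]].
  apply/andP; split; apply/negP => ij; apply/ijN/standard_monomialP.
    by exists [:: i; j]; rewrite //= ij.
  by exists [:: j; i]; rewrite /= ?ij // ijE; apply/mword_perm; rewrite (perm_catC [:: i]).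
rewrite ijE => /mword_perm; rewrite perm_sym => wij; have := perm_size wij.
case: w wij => [|k [|l []]] //= wij _; rewrite andbT.
have : k \in [:: i; j] by rewrite -(perm_mem wij) mem_head.
rewrite !inE => /orP[]/eqP kE; rewrite kE in wij *.
  move: wij; rewrite perm_cons => /(perm_mem) /(_ l); rewrite !inE eqxx => /esym /eqP ->.
  exact/negP.
have : perm_eq [:: j; l] [:: j; i] by rewrite (perm_trans wij) // (perm_catC [:: i]).
rewrite perm_cons => /(perm_mem) /(_ l); rewrite !inE eqxx => /esym /eqP ->.
exact/negP.
Qed.

(** Sorted by nonincreasing index, the word of a non-standard monomial has two neighbours that fail
    [wstd]. *)
Lemma nonstandard_factor (m : 'X_{1..s}) : ~ standard_monomial m -> exists m' i j,
  m = (m' + (U_(i) + U_(j)))%MM /\ ~ standard_monomial (U_(i) + U_(j))%MM.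
Proof.
have [w0 ->] := mword_surj m; pose w := sort (fun i j => (j <= i)%N) w0.
have /mword_perm <- : perm_eq w w0 by rewrite perm_sort.
have w_sorted : sorted (fun i j => (j <= i)%N) w by apply: sort_sorted => i j; exact: leq_total.
move=> mN; have wN : ~~ sorted wstd w.
  by apply/negP => ws; apply/mN/standard_monomialP; exists w.
have [a [i [j [c [wE ijN]]]]] := unsorted_split wN.
exists (mword (a ++ c)), i, j; split.
  rewrite wE /mword !big_cat /= !big_cons -!addmA; congr (_ + _)%MM.
  by rewrite addmA addmC.
(* In the reverse order they could be standard only if [i = j], which is the same pair. *)
apply/nonstandard_pair; rewrite ijN /=; apply/negP => ji.
have ji' : (j <= i)%N.
  have ge_trans : transitive (fun i j : 'I_s => (j <= i)%N).
    by move=> x y z yx zy; exact: leq_trans zy yx.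
  by move: w_sorted; rewrite wE => /(subseq_sorted ge_trans (suffix_subseq _ _)) /andP[].
have ij : i = j by apply/val_inj/anti_leq; rewrite (wstd_le b_gt0 ji) ji'.
by move: ijN ji; rewrite ij => /negP.
Qed.

Lemma tpowD v u : LSpath R b v -> LSpath R b u -> tpow b (v + u) = tpow b v * tpow b u.
Proof.
move=> vP uP; rewrite /tpow -mpolyXD; congr 'X_[_]; apply/mnmP => k; rewrite mnmDE.
apply/eqP; rewrite -(eqr_nat R) natrD !LSexpE //; last exact: LSpathD.
by rewrite mxE mulrDr.
Qed.

Lemma tpow0 : tpow b (0 : 'rV[R]_n.+1) = 1.
Proof.
rewrite /tpow (_ : LSexp b 0 = 0%MM) ?mpolyX0 //; apply/mnmP => k.
apply/eqP; rewrite -(eqr_nat R) LSexpE ?mxE ?mulr0 ?mnm0E //; exact: LSpath0.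
Qed.

Lemma prod_tpow w : \prod_(i <- w) tpow b (eta i) = tpow b (wsum w).
Proof.
elim: w => [|i w IHw]; first by rewrite /wsum !big_nil tpow0.
rewrite big_cons IHw wsum_cons tpowD //; first by case: (LSnthP b_gt0 i).
by case: (wsumP b_gt0 w).
Qed.

Lemma LSexp_inj v u : LSpath R b v -> LSpath R b u -> LSexp b v = LSexp b u -> v = u.
Proof. by move=> vP uP vu; rewrite -(LSexpK b_gt0 vP) vu LSexpK. Qed.

Lemma LSphi_mword w : LSphi R b 'X_[mword w] = tpow b (wsum w).
Proof. by rewrite /LSphi mmapX mmap1_mword prod_tpow. Qed.

Lemma coef_LSphi f m : (LSphi R b f)@_m =
  \sum_(m' <- msupp f) f@_m' * (LSphi R b 'X_[m'])@_m.
Proof.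
rewrite {1}/LSphi {1}/mmap linear_sum; apply: eq_bigr => m' _ /=.
by rewrite mcoeffCM /LSphi mmapX.
Qed.

(** A standard [m] is smallest in its fiber, so as an initial monomial it would be the only term of
    [f] in that fiber, and its coefficient would survive in the image. *)
Lemma initial_nonstandard f m : LSideal R b f ->
  is_initial_monomial (@grevlex_gt s) f m -> ~ standard_monomial m.
Proof.
move=> fI [mf m_lt] /standard_monomialP[p mE p_std].
have [pP _] := wsumP b_gt0 p.
have := coef_LSphi f (LSexp b (wsum p)); rewrite fI mcoeff0 (bigD1_seq m) //= mE LSphi_mword.
rewrite mcoeffX eqxx mulr1 big_seq_cond big1 ?addr0 => [/esym/eqP|m' /andP[m'f m'm]].
  by rewrite -mE mcoeff_eq0 mf.
have [q qE] := mword_surj m'; rewrite qE LSphi_mword mcoeffX.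
case: eqP => [/(LSexp_inj (proj1 (wsumP b_gt0 q)) pP) qp|_]; last by rewrite mulr0.
case: (@grevlex_gt_asym _ m m'); first by apply: m_lt => //; rewrite mE.
by rewrite mE qE; apply: std_word_grevlex => //; rewrite -qE; apply/eqP.
Qed.

Lemma straightening_exists i j : ~ standard_monomial (U_(i) + U_(j))%MM ->
  exists e1 e2, [/\ canonical_decomposition b (eta i + eta j) [:: eta e1; eta e2],
     is_initial_monomial (@grevlex_gt s) ('X_i * 'X_j - 'X_e1 * 'X_e2 : {mpoly R[i][s]})
       (U_(i) + U_(j))%MM
   & LSideal R b ('X_i * 'X_j - 'X_e1 * 'X_e2)].
Proof.
move=> ijN; have [w [sz w_std]] := std_word_exists b_gt0 (wsumP b_gt0 [:: i; j]).
case: w sz w_std => [|e1 [|e2 []]] //= _; rewrite andbT => e_std eij; exists e1, e2.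
have UE k l : (U_(k) + U_(l))%MM = mword [:: k; l] by rewrite /mword !big_cons big_nil addm0.
have XE k l : 'X_k * 'X_l = 'X_[mword [:: k; l]] :> {mpoly R[i][s]} by rewrite -UE mpolyXD.
have neq : mword [:: i; j] <> mword [:: e1; e2].
  move=> e; apply: ijN; rewrite UE e; apply/standard_monomialP; exists [:: e1; e2] => //=.
  by rewrite e_std.
have supp m : m \in msupp ('X_i * 'X_j - 'X_e1 * 'X_e2 : {mpoly R[i][s]}) =
    (m == mword [:: i; j]) || (m == mword [:: e1; e2]).
  rewrite mcoeff_msupp !XE mcoeffB !mcoeffX ![_ == m]eq_sym.
  case: (m =P mword [:: i; j]) => [->|_]; last first.
    by case: (m =P mword _); rewrite ?subrr ?sub0r ?oppr_eq0 ?oner_eq0 ?eqxx.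
  by have /eqP/negbTE -> := neq; rewrite subr0 oner_eq0.
split.
- split=> /=.
  + by move=> u; rewrite !inE => /orP[]/eqP->; exact: LSnthP.
  + by rewrite big_cons big_seq1; move: eij; rewrite /wsum !big_cons !big_nil !addr0.
  + by rewrite andbT.
- split; first by rewrite supp UE eqxx.
  move=> m; rewrite supp UE => /orP[/eqP-> /eqP//|/eqP-> _].
  by apply: std_word_grevlex => //=; rewrite e_std.
- by rewrite /LSideal /= !XE /LSphi raddfB /= -!/(LSphi _ _ _) !LSphi_mword eij subrr.
Qed.

Lemma straightening_groebner :
  groebner_basis (@grevlex_gt s) (LSideal R b) (straightening_relations R b).
Proof.
have GI : (straightening_relations R b `<=` LSideal R b)%classic.
  move=> g [p1 [p2 [e1 [e2 [_ [_ e12 _] ->]]]]].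
  have XE k l : 'X_k * 'X_l = 'X_[mword [:: k; l]] :> {mpoly R[i][s]}.
    by rewrite -mpolyXD /mword !big_cons big_nil addm0.
  rewrite /LSideal /= !XE /LSphi raddfB /= -!/(LSphi _ _ _) !LSphi_mword.
  by rewrite /wsum !big_cons !big_nil !addr0 e12 big_cons big_seq1 subrr.
split=> //.
- pose F (t : 'I_s * 'I_s * 'I_s * 'I_s) : {mpoly R[i][s]} :=
    'X_t.1.1.1 * 'X_t.1.1.2 - 'X_t.1.2 * 'X_t.2.
  apply: (@sub_finite_set _ _ (F @` setT)%classic); last exact/finite_image/finite_finset.
  by move=> g [p1 [p2 [e1 [e2 [_ _ ->]]]]]; exists (p1, p2, e1, e2).
apply/seteqP; split; apply: ideal_span_sub => _ [m [f fS mf] <-].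
  by exists 1, 'X_[m]; rewrite mul1r; split=> //; exists m => //; exists f => //; exact: GI.
(* The initial monomial is a multiple of a non-standard quadratic one, which is initial in its
   straightening relation. *)
have [m' [i [j [-> ijN]]]] := nonstandard_factor (initial_nonstandard fS mf).
have [e1 [e2 [cd ini _]]] := straightening_exists ijN.
exists 'X_[m'], 'X_[U_(i) + U_(j)]; split; last exact: mpolyXD.
by exists (U_(i) + U_(j))%MM => //; eexists; last exact: ini; exists i, j, e1, e2.
Qed.

End Straightening.

(** * The semigroup algebra *)

Section LSAlgebra.

Variables (R : realType) (n : nat) (b : 'I_n -> nat).
Hypothesis b_gt0 : forall i, (0 < b i)%N.

Local Notation s := (LSnum R b).
Local Notation eta := (@LSnth R n b).
Local Notation wstd := (@wstd R n b).
Local Notation alg := (LSalg R b).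
Implicit Types (i j : 'I_s) (p q w : seq 'I_s).

Lemma LSvecK m : LSexp b (LSvec R b m) = m.
Proof.
apply/mnmP => k; rewrite mnmE mxE mulrCA divff ?mulr1 ?natrK //.
by rewrite pnatr_eq0 -lt0n bond_lcm_gt0.
Qed.

Lemma msupp_LSpath (a : alg) m : m \in msupp (LSval a) -> LSpath R b (LSvec R b m).
Proof. by have := valP a => /allP aP /aP /set_mem. Qed.

Lemma LSval_linear : linear (@LSval R n b).
Proof. by move=> k a a'; rewrite -[LSval _]/(val _) linearP. Qed.

Definition LScoef w (a : alg) : R[i] := (LSval a)@_(LSexp b (wsum w)).

Lemma LScoef_linear w : scalar (LScoef w).
Proof. by move=> k a a'; rewrite /LScoef LSval_linear linearP. Qed.

HB.instance Definition _ w :=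
  GRing.isLinear.Build R[i] alg R[i] *%R (LScoef w) (LScoef_linear w).

Definition LSaug (a : alg) : R[i]^o := (LSval a)@_0%MM.

Lemma LSaug_linear : linear LSaug.
Proof. by move=> k a a'; rewrite /LSaug LSval_linear linearP. Qed.

HB.instance Definition _ := GRing.isLinear.Build R[i] alg R[i]^o *:%R LSaug LSaug_linear.

Lemma LSaug_monoid : monoid_morphism LSaug.
Proof.
split=> [|a a']; rewrite /LSaug; first by rewrite -[LSval _]/(val _) !rmorph1.
by rewrite -[LSval _]/(val _) !rmorphM.
Qed.

HB.instance Definition _ := GRing.isMonoidMorphism.Build alg R[i]^o LSaug LSaug_monoid.

Definition LSvar i : alg := MkLSalg (tpow_LSalg b_gt0 (proj1 (LSnthP b_gt0 i))).

Lemma LSval_mon w : LSval (mon LSvar w) = tpow b (wsum w).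
Proof. by rewrite -(prod_tpow b_gt0) -[LSval _]/(val _) rmorph_prod. Qed.

(** Distinct standard words have distinct sums, since otherwise each would be smaller than the
    other. *)
Lemma LScoef_mon p q : sorted wstd p -> sorted wstd q ->
  LScoef p (mon LSvar q) = (p == q)%:R.
Proof.
move=> ps qs; rewrite /LScoef LSval_mon mcoeffX; congr (nat_of_bool _)%:R.
apply/eqP/eqP => [|-> //].
move/(LSexp_inj b_gt0 (proj1 (wsumP b_gt0 q)) (proj1 (wsumP b_gt0 p))) => qp.
have [//|/andP[_ pq]] := std_word_min b_gt0 ps (esym qp).
have [//|/andP[_ /(ltn_trans pq)]] := std_word_min b_gt0 qs qp.
by rewrite ltnn.
Qed.

Lemma LS_normal_form w : exists p,
  [/\ sorted wstd p, mon LSvar p = mon LSvar w & p = w \/ word_lt p w].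
Proof.
have [p [_ ps pw]] := std_word_exists b_gt0 (wsumP b_gt0 w).
exists p; split=> //; last exact: std_word_min.
by apply: val_inj; rewrite /= !LSval_mon pw.
Qed.

Lemma LS_expansion (a : alg) : exists l : seq (seq 'I_s),
  all (sorted wstd) l /\ a = \sum_(p <- l) LScoef p a *: mon LSvar p.
Proof.
have /choice[f fP] : forall m : 'X_{1..n.+1}, exists w, LSpath R b (LSvec R b m) ->
    sorted wstd w /\ wsum w = LSvec R b m.
  (* Outside the monoid the empty word is a dummy value; such exponents do not occur in [a]. *)
  move=> m; have [mP|mN] := pselect (LSpath R b (LSvec R b m)); last by exists [::].
  have [d /(std_word_exists b_gt0)[w [_ ws wm]]] := LSdeg_nat b_gt0 mP.
  by exists w.
exists [seq f m | m <- msupp (LSval a)]; split.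
  by apply/allP => _ /mapP[m /msupp_LSpath /fP[fs _] ->].
apply: val_inj; rewrite /= {1}[LSval a]mpolyE big_map -[LSval (\sum_(_ <- _) _)]/(val _).
rewrite raddf_sum; apply: eq_big_seq => m /msupp_LSpath /fP[fs fE].
by rewrite -[RHS]/(val _) linearZ /= LSval_mon /LScoef fE /tpow LSvecK.
Qed.

Lemma LSdegD (v u : 'rV[R]_n.+1) : LSdeg (v + u) = LSdeg v + LSdeg u.
Proof. by rewrite -!psum_deg psumD. Qed.

Lemma LSdeg0 : LSdeg (0 : 'rV[R]_n.+1) = 0.
Proof. by rewrite /LSdeg big1 // => k _; rewrite mxE. Qed.

Lemma LSalg_gr_lin d k (a a' : alg) :
  LSalg_gr R b d a -> LSalg_gr R b d a' -> LSalg_gr R b d (k *: a + a').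
Proof.
move=> aP a'P m; rewrite LSval_linear => /msuppD_le.
by rewrite mem_cat => /orP[/msuppZ_le/aP|/a'P].
Qed.

Lemma LSalg_gr0 d : LSalg_gr R b d 0.
Proof. by move=> m; rewrite -[LSval _]/(val _) raddf0 msupp0. Qed.

Lemma LSalg_gr1 : LSalg_gr R b 0 1.
Proof.
by move=> m; rewrite -[LSval _]/(val _) rmorph1 msupp1 inE => /eqP ->; rewrite LSvec0 LSdeg0.
Qed.

Lemma LSalg_grM d e (a a' : alg) :
  LSalg_gr R b d a -> LSalg_gr R b e a' -> LSalg_gr R b (d + e) (a * a').
Proof.
move=> aP a'P m; rewrite -[LSval _]/(val _) rmorphM => /msuppM_le.
move=> /allpairsP[[m1 m2] /= [/aP m1P /a'P m2P ->]].
by rewrite LSvecD LSdegD m1P m2P natrD.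
Qed.

Lemma LSvar_gr i : LSalg_gr R b 1 (LSvar i).
Proof.
move=> m; rewrite /= msuppX inE => /eqP ->; have [iP i1] := LSnthP b_gt0 i.
by rewrite LSexpK.
Qed.

Lemma LSmon_gr w : LSalg_gr R b (size w) (mon LSvar w).
Proof.
move=> m; rewrite LSval_mon msuppX inE => /eqP ->; have [wP wd] := wsumP b_gt0 w.
by rewrite LSexpK.
Qed.

Lemma LSalg_decomposition (a : alg) : exists (m : nat) (x : nat -> alg),
  (forall d, LSalg_gr R b d (x d)) /\ a = \sum_(d < m) x d.
Proof.
have [l [_ aE]] := LS_expansion a.
(* Standard words are grouped by length. *)
exists (\max_(p <- l) size p).+1,
  (fun d => \sum_(p <- l | size p == d) LScoef p a *: mon LSvar p); split=> [d|].
  apply: (big_ind (LSalg_gr R b d)) => [|c c' cP c'P|p /eqP <-]; first exact: LSalg_gr0.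
    by rewrite -[c]scale1r; exact: LSalg_gr_lin.
  by rewrite -[_ *: _]addr0; apply: LSalg_gr_lin; [exact: LSmon_gr | exact: LSalg_gr0].
rewrite {1}aE (exchange_big_dep predT) //=; apply: eq_big_seq => p pl.
have pm : (size p < (\max_(p <- l) size p).+1)%N by rewrite ltnS; exact: leq_bigmax_seq.
by rewrite (big_pred1 (Ordinal pm)) // => d; rewrite -val_eqE eq_sym.
Qed.

Lemma LSalg_gr_unique (m : nat) (x : nat -> alg) : (forall d, LSalg_gr R b d (x d)) ->
  \sum_(d < m) x d = 0 -> forall d, (d < m)%N -> x d = 0.
Proof.
move=> xP x0 d dm; apply: val_inj; apply/mpolyP => m0; rewrite [X in _ = X@__]raddf0 mcoeff0 /=.
apply/eqP/negPn/negP; rewrite -mcoeff_msupp => m0d.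
have : (val (\sum_(d < m) x d))@_m0 = 0 by rewrite x0 !raddf0.
rewrite !raddf_sum.
rewrite (bigD1 (Ordinal dm)) //= big1 ?addr0 => [|e ed].
  by move=> /eqP; rewrite mcoeff_eq0 m0d.
apply/eqP; rewrite mcoeff_eq0; apply/negP => /xP; rewrite (xP _ _ m0d) => /eqP.
by rewrite eqr_nat => /eqP de; case/eqP: ed; apply/val_inj.
Qed.

(** Nonnegative coordinates with sum zero all vanish, so [a] has only a constant term. *)
Lemma LSalg_gr0_const (a : alg) : LSalg_gr R b 0 a -> a = (LSaug a)%:A.
Proof.
move=> aP; apply: val_inj; rewrite linearZ rmorph1; apply/mpolyP => m.
rewrite mcoeffZ mcoeff1 /=; have [->|mN] := eqVneq m 0%MM; first by rewrite mulr1.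
rewrite mulr0; apply/eqP; rewrite mcoeff_eq0; apply: contraNN mN => ma.
have [_ m0] := msupp_LSpath ma; have md := aP _ ma.
rewrite -[m]LSvecK -[0%MM]LSvecK LSvec0; apply/eqP; congr LSexp; apply/rowP => k.
by rewrite [RHS]mxE; apply: (psum_eq0P n.+1 m0).1 => //; rewrite psum_deg.
Qed.

Lemma LSalg_standard : standard_graded (LSalg_gr R b).
Proof.
split.
- split.
  + by move=> d; split=> [|k a a']; [exact: LSalg_gr0 | exact: LSalg_gr_lin].
  + exact: LSalg_gr1.
  + exact: LSalg_grM.
  + exact: LSalg_decomposition.
  + exact: LSalg_gr_unique.
- by move=> a /LSalg_gr0_const ->; eexists.
- exists s, LSvar; split=> [i|a]; first exact: LSvar_gr.
  have [l [_ ->]] := LS_expansion a.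
  exists (\sum_(p <- l) LScoef p a *: 'X_[mword p]); rewrite raddf_sum.
  by apply: eq_bigr => p _; rewrite /= mmapZ mmapX mmap1_mword /= -scalerAl mul1r.
Qed.

Lemma LSaugP (a : alg) : LSaug a = 0 <-> positive_part (LSalg_gr R b) a.
Proof.
have aug_pos d x : LSalg_gr R b d.+1 x -> LSaug x = 0.
  move=> xP; apply/eqP; rewrite /LSaug mcoeff_eq0; apply/negP => /xP /eqP.
  by rewrite LSvec0 LSdeg0 eq_sym pnatr_eq0.
split=> [|[m [x [xP ->]]]]; last first.
  rewrite raddf_sum big_nat big1 // => -[//|d] _; exact: (aug_pos d).
have [[|m] [x [xP aE]]] := LSalg_decomposition a.
  by move=> _; exists 0%N, x; split=> //; rewrite aE big_ord0 big_geq.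
move=> a0; exists m.+1, x; split=> //; move: a0.
rewrite aE -(big_mkord predT x) big_ltn // raddfD raddf_sum.
rewrite [X in _ + X = 0]big_nat [X in _ + X = 0]big1 ?addr0 => [x0|[//|d] _].
  by rewrite (LSalg_gr0_const (xP 0%N)) x0 scale0r add0r.
exact: (aug_pos d).
Qed.

End LSAlgebra.

Theorem theorem6p6 (R : realType) (n : nat) (b : 'I_n -> nat)
    (n_ge1 : (1 <= n)%N) (b_gt0 : forall i, (0 < b i)%N) :
  groebner_basis (@grevlex_gt (LSnum R b)) (LSideal R b)
      (straightening_relations R b)
  /\ @koszul R[i]%C (LSalg R b) (LSalg_gr R b).
Proof.
split; first exact: straightening_groebner.
apply: (@normal_words_koszul _ _ _ (@LSaug R n b) _ (LSvar b_gt0) (@wstd R n b) (@LScoef R n b)).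
- exact: LScoef_mon.
- exact: LS_normal_form.
- exact: LS_expansion.
- exact: LSalg_standard.
- exact: LSvar_gr.
- exact: LSaugP.
Qed.
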